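(* For all integers $t\ge 2$ and $k\ge 2$, $$\lim_{n\rightarrow\infty}\frac{C_{2(t-1)}(n,tk)}{n^k}=\frac{1}{k!}\cdot \frac{1}{\binom{tk-1}{k-1}}.$$
   Context: An $r$-graph on a vertex set $V$ is a family of distinct $r$-element subsets of $V$ (its edges). For a positive integer $s$, an $r$-graph $\mathcal{H}$ is called $s$-cancellative if for arbitrary $s+2$ distinct edges $A_1,\ldots,A_s,B,C\in\mathcal{H}$, it holds that $(\bigcup_{i=1}^s A_i)\cup B\neq (\bigcup_{i=1}^s A_i)\cup C$. $C_s(n,r)$ denotes the maximum number of edges that can be contained in an $s$-cancellative $r$-graph on $n$ vertices. *)

(* Defs.v *)
From mathcomp Require Import all_boot.

Set Implicit Arguments.
Unset Strict Implicit.
Unset Printing Implicit Defensive.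

Definition rgraph (T : finType) (r : nat) (H : {set {set T}}) : bool :=
  [forall A in H, #|A| == r].

(* A lists the edges A_1, ..., A_s; [uniq [:: B, C & A]] says that the s + 2
   edges A_1, ..., A_s, B, C are pairwise distinct. *)
Definition cancellative (T : finType) (s : nat) (H : {set {set T}}) : bool :=
  [forall A : s.-tuple {set T}, forall B : {set T}, forall C : {set T},
     [&& all (fun X => X \in H) A, B \in H, C \in H & uniq [:: B, C & A]] ==>
     ((\bigcup_(i < s) tnth A i) :|: B != (\bigcup_(i < s) tnth A i) :|: C)].

Definition maxCancellative (s n r : nat) : nat :=
  \max_(H : {set {set 'I_n}} | rgraph r H && cancellative s H) #|H|.

(* Main.v *)
(* Upper bound: charge to an edge A the k-subsets of A lying in no other edge, and those occurring in
   some decomposition of A into t k-sets all of which lie in other edges.  If X were charged to two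
   edges A and C, then X would occur in such a decomposition of both, and the at most t - 1 further
   edges around the remaining parts of each would together cover the symmetric difference of A and C,
   against cancellativity.  Every decomposition of A has a charged part, so by averaging over
   permutations of A at least C(tk, k) / t = C(tk - 1, k - 1) sets are charged to A.

   Lower bound: random deletion yields a gadget, a sparse tk-graph on a fixed set W with almost as
   few as C(tk - 1, k - 1) k-subsets of edges ("shadow") per edge.  Its shadow embeds in an
   edge-transitive k-graph containing almost all k-subsets of its vertex set, and a blow-up of that
   k-graph is covered regularly by the copies of the shadow.  The Rödl nibble packs almost all edges
   of the blow-up with edge-disjoint copies avoiding locally dense configurations, and placing a
   gadget on each copy gives a 2(t - 1)-cancellative tk-graph. *)

From mathcomp Require Import all_boot all_order all_algebra all_fingroup.
From mathcomp Require Import ring lra zify.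
Require Import Defs.

Set Implicit Arguments.
Unset Strict Implicit.
Unset Printing Implicit Defensive.
Import Order.TTheory GRing.Theory Num.Theory.

Local Open Scope ring_scope.

(** * Random subsets and the nibble *)

(** Edge-disjointness of the packed shadows is not enough: an edge of one copy must meet the whole
    vertex set of any other copy in fewer than [k] points, although a [k]-subset of a copy need not
    be a shadow set. Hence shadows sit in the host as induced subgraphs: a [k]-set common to an edge
    of one copy and the vertices of another is an edge of the blow-up, hence a shadow set of both. A
    complete host does not give this in general, so the host is built from colours in a finite
    field; edge-transitivity makes the hypergraph of copies regular, as the nibble requires.

    The number [C(tk - 1, k - 1)] arises by giving each gadget edge a private vertex: so many
    [k]-subsets of the edge contain it, while all other shadow sets lie in a base set with
    negligibly many [k]-subsets compared with the number of edges.

    Both random constructions forbid [e] sets of size [w] spanning fewer than [e (w - k) + k]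
    points. Below this threshold the expected number of bad families loses a factor of the blow-up
    size, so deletion is cheap; the threshold itself is just enough for counting overlaps in the
    covering arguments. *)

Lemma card_bigcup_le (I T : finType) (P : pred I) (F : I -> {set T}) :
  (#|\bigcup_(i | P i) F i| <= \sum_(i | P i) #|F i|)%N.
Proof.
elim/big_rec2: _ => [|i m A _ leA]; first by rewrite cards0.
by apply: leq_trans (leq_card_setU _ _) _; rewrite leq_add2l.
Qed.

(** Deleting one element from each member of [BB] inside [S] destroys them all. The empty set has to
    be excluded since nothing can be removed from it. *)
Lemma delete_bad (E : finType) (BB : {set {set E}}) (S : {set E}) : set0 \notin BB ->
  exists M : {set E}, [/\ M \subset S, forall B, B \in BB -> ~~ (B \subset M) &
    (#|S| <= #|M| + #|[set B in BB | B \subset S]|)%N].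
Proof.
move=> BB0; set BS := [set B in BB | _].
pose x (B : {set E}) := if [pick e in B] is Some e then [set e] else set0.
exists (S :\: \bigcup_(B in BS) x B); split; first exact: subsetDl.
  move=> B BBB; apply/negP => BM.
  have BBS : B \in BS by rewrite inE BBB (subset_trans BM) ?subsetDl.
  have [B0|[e eB]] := set_0Vmem B; first by case/negP: BB0; rewrite -B0.
  have [e' e'B e'x] : exists2 e', e' \in B & e' \in x B.
    rewrite /x; case: pickP => [e' e'B|B0]; last by have := B0 e; rewrite eB.
    by exists e' => //; rewrite inE.
  have := subsetP BM e' e'B.
  by rewrite inE => /andP[/bigcupP[]]; exists B.
rewrite -(cardsID (\bigcup_(B in BS) x B) S) addnC leq_add2l.
apply: leq_trans (subset_leq_card (subsetIr _ _)) _.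
apply: leq_trans (card_bigcup_le _ _) _.
rewrite -sum1_card; apply: leq_sum => B _; rewrite /x.
by case: pickP => [e _|_]; rewrite ?cards1 ?cards0.
Qed.

Lemma natr_card (R : pzSemiRingType) (T : finType) (A : {set T}) : #|A|%:R = \sum_x (x \in A)%:R :> R.
Proof. by rewrite -sum1_card natr_sum big_mkcond; apply: eq_bigr => x _; case: (x \in A). Qed.

Section RandomSubset.
Variables (R : realFieldType) (E : finType) (p : R).
Hypothesis p01 : 0 <= p <= 1.

Definition rsub_weight (S : {set E}) : R := \prod_e (if e \in S then p else 1 - p).

(** Expectation of [f] at a random subset that contains each element independently with probability
    [p], as a finite sum. *)
Definition rsub (f : {set E} -> R) : R := \sum_S rsub_weight S * f S.

Lemma rsub_weight_ge0 S : 0 <= rsub_weight S.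
Proof.
case/andP: p01 => p0 p1; apply: prodr_ge0 => e _.
by case: ifP; rewrite ?subr_ge0.
Qed.

(** Independence, by distributivity. The probabilities of containing or of missing a fixed set are
    special cases. *)
Lemma rsub_prod (a b : E -> R) :
  rsub (fun S => \prod_e (if e \in S then a e else b e)) =
  \prod_e (p * a e + (1 - p) * b e).
Proof.
rewrite (@bigA_distr R 0 1 *%R +%R); apply: eq_bigr => S _.
by rewrite -big_split /=; apply: eq_bigr => e _; case: ifP.
Qed.

Lemma eq_rsub f1 f2 : f1 =1 f2 -> rsub f1 = rsub f2.
Proof. by move=> eqf; apply: eq_bigr => S _; rewrite eqf. Qed.

Lemma rsubD f1 f2 : rsub (fun S => f1 S + f2 S) = rsub f1 + rsub f2.
Proof. by rewrite -big_split; apply: eq_bigr => S _; rewrite mulrDr. Qed.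

Lemma rsubZ c f : rsub (fun S => c * f S) = c * rsub f.
Proof. by rewrite mulr_sumr; apply: eq_bigr => S _; rewrite mulrCA. Qed.

Lemma rsub_le f1 f2 : (forall S, f1 S <= f2 S) -> rsub f1 <= rsub f2.
Proof. by move=> lef; apply: ler_sum => S _; rewrite ler_wpM2l ?rsub_weight_ge0. Qed.

Lemma rsub_disjoint (F : {set E}) :
  rsub (fun S => [disjoint S & F]%:R) = (1 - p) ^+ #|F|.
Proof.
have -> : (1 - p) ^+ #|F| =
  \prod_e (p * (e \notin F)%:R + (1 - p) * 1).
  rewrite -prodr_const [LHS]big_mkcond /=; apply: eq_bigr => e _.
  by case: (e \in F) => /=; ring.
rewrite -rsub_prod; apply: eq_rsub => S.
have [dSF|/pred0Pn[e /andP[/= eS eF]]] := boolP [disjoint S & F].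
  rewrite big1 // => e _; case: ifP => // eS.
  by rewrite (disjointFr dSF eS).
by rewrite (bigD1 e) //= eS eF mul0r.
Qed.

Lemma rsub_subset (F : {set E}) : rsub (fun S => (F \subset S)%:R) = p ^+ #|F|.
Proof.
have -> : p ^+ #|F| = \prod_e (p * 1 + (1 - p) * (e \notin F)%:R).
  rewrite -prodr_const [LHS]big_mkcond /=; apply: eq_bigr => e _.
  by case: (e \in F) => /=; ring.
rewrite -rsub_prod; apply: eq_rsub => S.
have [sFS|/subsetPn[e eF eNS]] := boolP (F \subset S).
  rewrite big1 // => e _; case: ifPn => // eS.
  by rewrite (contra (subsetP sFS e)).
by rewrite (bigD1 e) //= (negPf eNS) eF mul0r.
Qed.

Lemma rsub_cst c : rsub (fun=> c) = c.
Proof.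
transitivity (c * rsub (fun S => [disjoint S & set0]%:R)); last first.
  by rewrite rsub_disjoint cards0 expr0 mulr1.
by rewrite -rsubZ; apply: eq_rsub => S; rewrite disjoint_sym disjoints_subset sub0set mulr1.
Qed.

Lemma rsub_exists f : exists S, rsub f <= f S.
Proof.
have [x xP] : exists x : {set E}, forall S, f S <= f x.
  exists [arg max_(x > set0) f x]%O; case: Order.TotalTheory.arg_maxP => // x _ xm S; exact: xm.
by exists x; rewrite -[leRHS]rsub_cst; apply: rsub_le.
Qed.

Lemma rsub_sum (I : Type) (r : seq I) (P : pred I) (F : I -> {set E} -> R) :
  rsub (fun S => \sum_(i <- r | P i) F i S) = \sum_(i <- r | P i) rsub (F i).
Proof. by rewrite exchange_big /=; apply: eq_bigr => S _; rewrite mulr_sumr. Qed.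

Lemma random_deletion (BB : {set {set E}}) : set0 \notin BB ->
  exists M : {set E}, (forall B, B \in BB -> ~~ (B \subset M)) /\
    p * #|E|%:R - \sum_(B in BB) p ^+ #|B| <= #|M|%:R.
Proof.
move=> BB0.
have [S le] := rsub_exists (fun S : {set E} => #|S|%:R - \sum_(B in BB) (B \subset S)%:R).
have [M [_ M1 M2]] := delete_bad S BB0.
exists M; split=> //; apply: (@le_trans _ _ (#|S|%:R - \sum_(B in BB) (B \subset S)%:R)).
  apply: le_trans le; rewrite -mulN1r -[X in _ <= X](_ : rsub (fun S : {set E} =>
     \sum_e ([set e] \subset S)%:R + -1 * \sum_(B in BB) (B \subset S)%:R) = _); last first.
    apply: eq_rsub => S'; rewrite mulN1r natr_card; congr (_ - _).
    by apply: eq_bigr => e _; rewrite sub1set.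
  rewrite rsubD rsubZ !rsub_sum lerD //.
    under eq_bigr do rewrite rsub_subset cards1 expr1.
    by rewrite sumr_const mulr_natr.
  by rewrite !mulN1r lerN2; apply: ler_sum => B _; rewrite rsub_subset.
rewrite lerBlDr; apply: (@le_trans _ _ (#|M|%:R + #|[set B in BB | B \subset S]|%:R)).
  by rewrite -natrD ler_nat.
rewrite lerD2l natr_card [leRHS]big_mkcond; apply: ler_sum => B _.
by rewrite inE; case: (B \in BB).
Qed.

End RandomSubset.

(** * The random nibble process *)

Section Nibble.
Variables (R : realFieldType) (V E : finType) (inc : E -> {set V}) (p : R).
Hypothesis p01 : 0 <= p <= 1.

(** [picked] collects every edge ever selected, even one no longer inside [alive], so that its law
    does not depend on the course of the process; [matched] holds the packing. *)
Record nstate := NState {alive : {set V}; picked : {set E}; matched : {set E}}.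

Definition live (A : {set V}) (S : {set E}) := [set e in S | inc e \subset A].

Definition isolated (L : {set E}) :=
  [set e in L | [forall f in L, (f != e) ==> [disjoint inc e & inc f]]].

(** Conflicting selected edges are not matched, but their vertices die as well. Thus a vertex set
    survives exactly when no live edge meeting it is selected, an event of explicit probability. *)
Definition nstep (S : {set E}) (s : nstate) :=
  NState (alive s :\: \bigcup_(e in live (alive s) S) inc e)
         (picked s :|: S) (matched s :|: isolated (live (alive s) S)).

(** Expectation of [f] after [n] rounds. The recursion absorbs the last round into [f], so
    inductions on [n] generalise over [f]. *)
Fixpoint nrun (n : nat) (f : nstate -> R) (s : nstate) : R :=
  if n is n'.+1 then nrun n' (fun s' => rsub p (fun S => f (nstep S s'))) s
  else f s.

Lemma eq_nrun n f1 f2 s : f1 =1 f2 -> nrun n f1 s = nrun n f2 s.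
Proof.
elim: n f1 f2 => [|n IHn] f1 f2 eqf /=; first exact: eqf.
by apply: IHn => s'; apply: eq_rsub => S.
Qed.

Lemma nrunD n f1 f2 s :
  nrun n (fun s => f1 s + f2 s) s = nrun n f1 s + nrun n f2 s.
Proof.
elim: n f1 f2 => [|n IHn] f1 f2 //=.
by rewrite -IHn; apply: eq_nrun => s'; rewrite rsubD.
Qed.

Lemma nrunZ n c f s : nrun n (fun s => c * f s) s = c * nrun n f s.
Proof.
elim: n f => [|n IHn] f //=.
by rewrite -IHn; apply: eq_nrun => s'; rewrite rsubZ.
Qed.

Lemma nrun_le_inv (inv : nstate -> Prop) n f1 f2 s :
  inv s -> (forall s S, inv s -> inv (nstep S s)) ->
  (forall s, inv s -> f1 s <= f2 s) -> nrun n f1 s <= nrun n f2 s.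
Proof.
move=> invs invS; elim: n f1 f2 => [|n IHn] f1 f2 lef /=; first exact: lef.
by apply: IHn => s' invs'; apply: rsub_le => // S; apply/lef/invS.
Qed.

Lemma nrun_le n f1 f2 s : (forall s, f1 s <= f2 s) -> nrun n f1 s <= nrun n f2 s.
Proof. by move=> lef; apply: (@nrun_le_inv (fun=> True)). Qed.

Lemma nrun_cst n c s : nrun n (fun=> c) s = c.
Proof.
elim: n => [|n IHn] //=; rewrite -[RHS]IHn.
by apply: eq_nrun => s'; rewrite rsub_cst.
Qed.

Lemma nrun_sum n (I : Type) (r : seq I) (P : pred I) (F : I -> nstate -> R) s :
  nrun n (fun s => \sum_(i <- r | P i) F i s) s = \sum_(i <- r | P i) nrun n (F i) s.
Proof.
elim: n F => [|n IHn] F //=.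
by rewrite -IHn; apply: eq_nrun => s'; rewrite rsub_sum.
Qed.

Lemma nrun_exists (inv : nstate -> Prop) n f s :
  inv s -> (forall s S, inv s -> inv (nstep S s)) ->
  exists2 s', inv s' & nrun n f s <= f s'.
Proof.
move=> invs invS; elim: n f => [|n IHn] f /=; first by exists s.
have [s' invs' lef] := IHn (fun s' => rsub p (fun S => f (nstep S s'))).
have [S leS] := rsub_exists p01 (fun S => f (nstep S s')).
by exists (nstep S s'); [apply: invS | apply: le_trans lef leS].
Qed.

Definition nmatching (A : {set V}) (M : {set E}) :=
  [forall e in M, [disjoint inc e & A] &&
    [forall f in M, (f != e) ==> [disjoint inc e & inc f]]].

Lemma nstep_matching S s : nmatching (alive s) (matched s) ->
  nmatching (alive (nstep S s)) (matched (nstep S s)).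
Proof.
move=> /forall_inP mM; apply/forall_inP => e; rewrite inE.
set L := live (alive s) S => eMI.
have isoP f : f \in isolated L -> [/\ f \in L, inc f \subset alive s
    & forall h, h \in L -> h != f -> [disjoint inc f & inc h]].
  rewrite inE => /andP[fL /forall_inP fiso]; split=> //.
    by move: fL; rewrite inE => /andP[].
  by move=> h hL hf; apply: (implyP (fiso h hL)).
have MI f h : f \in matched s -> h \in isolated L -> [disjoint inc f & inc h].
  move=> fM /isoP[_ sh _]; case/andP: (mM f fM) => dfA _.
  by rewrite disjoint_sym (disjointWl sh) // disjoint_sym.
apply/andP; split; last first.
  apply/forall_inP => f; rewrite inE => fMI; apply/implyP => fe.
  case/orP: eMI => eM; case/orP: fMI => fM.
  - by case/andP: (mM e eM) => _ /forall_inP /(_ f fM) /implyP; apply.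
  - exact: MI.
  - by rewrite disjoint_sym; apply: MI.
  - case/isoP: eM => _ _; apply=> //; by case/isoP: fM.
case/orP: eMI => [eM | /isoP[eL _ _]].
  case/andP: (mM e eM) => deA _.
  by rewrite (disjointWr _ deA) //= subsetDl.
rewrite disjoint_sym disjoints_subset /=; apply/subsetP => v.
rewrite !inE => /andP[vN _]; apply: contra vN => ve.
by apply/bigcupP; exists e.
Qed.

(** Let [h y] be the product of [y] over the members of [B] not yet picked. One round takes [h y] to
    at most [h (p + y)], as [p + (1 - p) y <= p + y]. At [y = 0] this is the indicator of [B] being
    picked, and [n] rounds lead to [y = n p]. *)
Lemma nrun_picked (B : {set E}) n s0 : picked s0 = set0 ->
  nrun n (fun s => (B \subset picked s)%:R) s0 <= (n%:R * p) ^+ #|B|.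
Proof.
move=> s00; case/andP: p01 => p0 p1.
pose h y (s : nstate) : R := \prod_e (if (e \in B) && (e \notin picked s) then y else 1).
have hstep y s : 0 <= y -> rsub p (fun S => h y (nstep S s)) <= h (p + y) s.
  move=> y0; have -> : rsub p (fun S => h y (nstep S s)) =
      rsub p (fun S => \prod_e (if e \in S then 1 else
         if (e \in B) && (e \notin picked s) then y else 1)).
    apply: eq_rsub => S; apply: eq_bigr => e _; rewrite /= !inE negb_or.
    by case: (e \in S); rewrite ?andbF ?andbT.
  rewrite rsub_prod; apply: ler_prod => e _; case: ifP => _.
    by apply/andP; split; nra.
  by apply/andP; split; lra.
have hle n' y : 0 <= y -> nrun n' (h y) s0 <= h (n'%:R * p + y) s0.
  elim: n' y => [|m IHm] y y0 /=; first by rewrite mul0r add0r.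
  apply: le_trans (nrun_le m s0 (fun s => hstep y s y0)) _.
  apply: le_trans (IHm _ _) _; first by rewrite addr_ge0.
  by rewrite addrA -[m.+1%:R]natr1 mulrDl mul1r.
have -> : (n%:R * p) ^+ #|B| = h (n%:R * p + 0) s0.
  rewrite /h addr0 s00 -prodr_const big_mkcond /=.
  by apply: eq_bigr => e _; rewrite inE andbT.
apply: le_trans (hle n 0 (lexx _)); apply: nrun_le => s.
have [sB|/subsetPn[e eB eN]] := boolP (B \subset picked s); last first.
  by apply: prodr_ge0 => f _; case: ifP.
rewrite /h big1 // => e _; case: ifP => // /andP[eB].
by rewrite (subsetP sB).
Qed.

Definition nhit (A X : {set V}) := [set e | (inc e \subset A) && ~~ [disjoint inc e & X]].

Lemma rsub_alive (X : {set V}) s :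
  rsub p (fun S => (X \subset alive (nstep S s))%:R) =
  (X \subset alive s)%:R * (1 - p) ^+ #|nhit (alive s) X|.
Proof.
rewrite -rsub_disjoint -rsubZ; apply: eq_rsub => S /=.
rewrite -natrM mulnb subsetD; congr ((_ && _)%:R).
apply/idP/idP => dX.
  rewrite disjoints_subset; apply/subsetP => e eS; rewrite !inE.
  apply/negP => /andP[eA]; apply/negP/negPn.
  by rewrite disjoint_sym; apply: (bigcup_disjointP dX); rewrite inE eS.
apply/bigcup_disjointP => e; rewrite inE => /andP[eS eA].
apply: contraTT dX; rewrite disjoint_sym => ne; apply/pred0Pn; exists e.
by rewrite /= eS inE eA.
Qed.

(** A selected live edge that is not isolated is the first entry of an ordered pair of distinct
    intersecting selected edges. A live edge has at most [g D] partners, and both entries are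
    selected with probability [p ^ 2]. *)
Lemma rsub_matched (g D : nat) s :
  (forall e, #|inc e| = g) ->
  (forall v, (#|[set e | v \in inc e]| <= D)%N) ->
  nmatching (alive s) (matched s) -> (0 < g)%N ->
  #|matched s|%:R + p * #|live (alive s) setT|%:R * (1 - p * (g * D)%:R)
   <= rsub p (fun S => #|matched (nstep S s)|%:R).
Proof.
move=> cardg degD mM g0; case/andP: p01 => p0 p1.
set LL := live (alive s) setT.
have disjM S : [disjoint matched s & isolated (live (alive s) S)].
  rewrite disjoints_subset; apply/subsetP => e eM; rewrite !inE.
  apply/negP => /andP[/andP[_ eA] _].
  have /andP[dA _] := forall_inP mM e eM.
  have : inc e == set0 by rewrite -subset0 -(disjoint_setI0 dA) subsetI eA subxx.
  by rewrite -cards_eq0 cardg; case: (g) g0.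
pose pr := [set ef : E * E | [&& ef.1 \in LL, ef.2 \in LL, ef.1 != ef.2 & ~~ [disjoint inc ef.1 & inc ef.2]]].
have cpr : (#|pr| <= #|LL| * (g * D))%N.
  have -> : #|pr| = (\sum_(e in LL) \sum_(f in [set f | (e, f) \in pr]) 1)%N.
    rewrite pair_big_dep -sum1_card; apply: eq_bigl => -[e f] /=.
    by apply/esym; rewrite (_ : (f \in [set f | (e, f) \in pr]) = ((e, f) \in pr));
      [apply: andb_idl; rewrite inE => /andP[] | rewrite inE].
  rewrite -sum_nat_const; apply: leq_sum => e eL.
  rewrite sum1_card.
  have sub : [set f | (e, f) \in pr] \subset \bigcup_(v in inc e) [set f | v \in inc f].
    apply/subsetP => f; rewrite !inE /= => /and4P[_ _ _ /pred0Pn[v /andP[/= ve vf]]].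
    by apply/bigcupP; exists v => //; rewrite inE.
  apply: leq_trans (subset_leq_card sub) _.
  apply: leq_trans (card_bigcup_le _ _) _.
  by rewrite -(cardg e) -sum_nat_const; apply: leq_sum => v _; apply: degD.
have key (S : {set E}) : #|matched s|%:R + \sum_(e in LL) ([set e] \subset S)%:R -
    \sum_(ef in pr) ([set ef.1; ef.2] \subset S)%:R <= #|matched (nstep S s)|%:R :> R.
  rewrite /= cardsU (disjoint_setI0 (disjM S)) cards0 subn0 natrD -addrA lerD2l lerBlDr.
  have -> : \sum_(e in LL) ([set e] \subset S)%:R = #|live (alive s) S|%:R :> R.
    rewrite natr_card [LHS]big_mkcond; apply: eq_bigr => e _.
    by rewrite sub1set !inE /=; case: (e \in S); case: (inc e \subset _).
  have -> : \sum_(ef in pr) ([set ef.1; ef.2] \subset S)%:R =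
     #|[set ef in pr | [set ef.1; ef.2] \subset S]|%:R :> R.
    rewrite natr_card [LHS]big_mkcond; apply: eq_bigr => e _.
    by rewrite [in RHS]inE; case: (e \in pr).
  rewrite -natrD ler_nat.
  set P2 := [set ef in pr | _].
  have sub : live (alive s) S \subset isolated (live (alive s) S) :|: [set ef.1 | ef in P2].
    apply/subsetP => e eL; rewrite inE; case: (boolP (e \in isolated _)) => //=.
    rewrite inE eL /= => /forall_inPn[f fL]; rewrite negb_imply => /andP[fe nd].
    apply/imsetP; exists (e, f) => //.
    rewrite !inE /=; move: eL fL; rewrite !inE => /andP[eS ->] /andP[fS ->] /=.
    by rewrite eq_sym fe nd subUset !sub1set eS fS.
  apply: leq_trans (subset_leq_card sub) _.
  apply: leq_trans (leq_card_setU _ _) _.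
  by rewrite leq_add2l leq_imset_card.
apply: le_trans (rsub_le p01 key).
rewrite -[leRHS]/(rsub p (fun S => _ + (- _))) rsubD rsubD rsub_cst rsub_sum.
rewrite -[rsub _ (fun _ => - _)]/(rsub p (fun S : {set E} => - \sum_(ef in pr) ([set ef.1; ef.2] \subset S)%:R)).
have -> : rsub p (fun S : {set E} => - \sum_(ef in pr) ([set ef.1; ef.2] \subset S)%:R) =
   - \sum_(ef in pr) p ^+ 2.
  rewrite -mulN1r -[X in -1 * X](_ :
      rsub p (fun S : {set E} => \sum_(ef in pr) ([set ef.1; ef.2] \subset S)%:R) = _).
    by rewrite -rsubZ; apply: eq_rsub => S; rewrite mulN1r.
  rewrite rsub_sum; apply: eq_bigr => ef; rewrite !inE => /and4P[_ _ ne _].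
  by rewrite rsub_subset cards2 ne.
have -> : \sum_(i in LL) rsub p (fun S : {set E} => ([set i] \subset S)%:R) = p * #|LL|%:R.
  rewrite (eq_bigr (fun=> p)); last by move=> e _; rewrite rsub_subset cards1 expr1.
  by rewrite sumr_const mulr_natr.
rewrite sumr_const -[_ *+ #|pr|]mulr_natr -addrA lerD2l mulrBr mulr1 lerD2l lerN2.
rewrite expr2 -!mulrA ler_wpM2l // [leRHS]mulrCA ler_wpM2l // -natrM ler_nat.
exact: cpr.
Qed.

End Nibble.

Record regular_hypergraph (V E : finType) (inc : E -> {set V}) (V0 : {set V})
    (g D K : nat) : Prop := RegularHypergraph {
  rh_card : forall e, #|inc e| = g;
  rh_sub : forall e, inc e \subset V0;
  rh_deg : forall v, v \in V0 -> #|[set e | v \in inc e]| = D;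
  rh_codeg : forall u v, u != v ->
    (#|[set e | (u \in inc e) && (v \in inc e)]| <= K)%N
}.

(** Idealised probability [q] that a vertex is alive after [i] rounds: given that it is alive, about
    [D q ^ (g - 1)] edges through it are live, and none of them may be selected. The truncation
    makes this number an exponent. *)
Fixpoint survival (R : archiRealFieldType) (g D : nat) (eps : R) (i : nat) : R :=
  if i is i'.+1 then
    survival g D eps i' *
    (1 - eps / D%:R) ^+ Num.truncn (D%:R * survival g D eps i' ^+ g.-1)
  else 1.

Section NibbleRound.
Variables (R : archiRealFieldType) (V E : finType) (inc : E -> {set V}).
Variables (V0 : {set V}) (g D K : nat) (eps : R).
Hypotheses (g_gt0 : (0 < g)%N) (D_gt0 : (0 < D)%N) (eps01 : 0 <= eps <= 1).
Hypothesis rh : regular_hypergraph inc V0 g D K.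

Let p : R := eps / D%:R.
Let q := survival g D eps.
Let s0 : nstate V E := NState V0 set0 set0.
Let P i (X : {set V}) := nrun inc p i (fun s => (X \subset alive s)%:R) s0.

Lemma pick_prob01 : 0 <= eps / D%:R <= 1.
Proof.
case/andP: eps01 => e0 e1; rewrite divr_ge0 //= ler_pdivrMr ?ltr0n // mul1r.
by rewrite (le_trans e1) // ler1n.
Qed.

Lemma survival01 i : 0 <= survival g D eps i <= 1.
Proof.
case/andP: pick_prob01 => p0 p1.
elim: i => [|i /andP[q0 q1]] /=; first by rewrite ler01 lexx.
rewrite mulr_ge0 ?exprn_ge0 ?subr_ge0 //= mulr_ile1 ?exprn_ge0 ?subr_ge0 //.
by rewrite exprn_ile1 ?subr_ge0 // lerBlDr lerDl.
Qed.

Definition adeg (A : {set V}) v := #|[set e | (v \in inc e) && (inc e \subset A)]|.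

Lemma deg_le v : (#|[set e | v \in inc e]| <= D)%N.
Proof.
have [vV|vN] := boolP (v \in V0); first by rewrite (rh_deg rh).
rewrite (_ : [set e | _] = set0) ?cards0 //; apply/setP => e; rewrite !inE.
by apply: contraNF vN; apply: subsetP (rh_sub rh e) v.
Qed.

(** The sum of live degrees counts an edge once per vertex in [X]; the excess is at most the number
    of ordered pairs of distinct vertices of [X] in a common edge, whence the codegree bound. *)
Lemma nhit_adeg (A X : {set V}) :
  `|#|nhit inc A X|%:R - \sum_(v in X) (adeg A v)%:R| <= (#|X| ^ 2 * K)%:R :> R.
Proof.
have eD : (\sum_(v in X) adeg A v = \sum_(e | inc e \subset A) #|inc e :&: X|)%N.
  rewrite (eq_bigr (fun v => \sum_(e | inc e \subset A) (v \in inc e))%N); last first.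
    move=> v _; rewrite /adeg -sum1_card big_mkcond [RHS]big_mkcond /=.
    by apply: eq_bigr => e _; rewrite inE andbC; case: (inc e \subset A) => //=; case: (v \in _).
  rewrite exchange_big /=; apply: eq_bigr => e _.
  rewrite -sum1_card big_mkcond [RHS]big_mkcond /=.
  by apply: eq_bigr => v _; rewrite inE andbC; case: (v \in X) => //=; case: (v \in _).
have eL : (#|nhit inc A X| = \sum_(e | inc e \subset A) ~~ [disjoint inc e & X])%N.
  rewrite -sum1_card big_mkcond [RHS]big_mkcond /=.
  by apply: eq_bigr => e _; rewrite inE; case: (inc e \subset A) => //=; case: [disjoint _ & _].
have leL : (#|nhit inc A X| <= \sum_(v in X) adeg A v)%N.
  rewrite eD eL; apply: leq_sum => e _; case: (boolP [disjoint _ & _]) => //= nd.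
  by rewrite card_gt0 setI_eq0.
have leD : (\sum_(v in X) adeg A v <= #|nhit inc A X| + #|X| ^ 2 * K)%N.
  have leK : (\sum_(u in X) \sum_(v in X | v != u) #|[set e | (u \in inc e) && (v \in inc e)]|
             <= #|X| ^ 2 * K)%N.
    rewrite expnS expn1 -mulnA -!sum_nat_const; apply: leq_sum => u _.
    rewrite [leqRHS]big_mkcond [leqLHS]big_mkcond; apply: leq_sum => v _.
    by case: (v \in X) => //=; case: ifP => // vu; apply: (rh_codeg rh); rewrite eq_sym.
  apply: leq_trans (leq_add (leqnn _) leK); rewrite eD eL.
  have -> : (\sum_(u in X) \sum_(v in X | v != u) #|[set e | (u \in inc e) && (v \in inc e)]|
     = \sum_e \sum_(u in X) \sum_(v in X | v != u)
        ((u \in inc e) && (v \in inc e)))%N.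
    rewrite exchange_big /=; apply: eq_bigr => u _.
    rewrite exchange_big /=; apply: eq_bigr => v _.
    rewrite -sum1_card big_mkcond /=; apply: eq_bigr => e _.
    by rewrite inE; case: (_ && _).
  apply: (@leq_trans (\sum_(e | inc e \subset A) ~~ [disjoint inc e & X] +
     \sum_(e | inc e \subset A) \sum_(u in X) \sum_(v in X | v != u)
        ((u \in inc e) && (v \in inc e)))%N); last first.
    by rewrite leq_add2l [leqLHS]big_mkcond /=; apply: leq_sum => e _; case: ifP.
  rewrite -big_split /=; apply: leq_sum => e _.
  case: (boolP [disjoint _ & _]) => [d|/pred0Pn[u /andP[/= ue uX]]].
    by rewrite (eqP (_ : inc e :&: X == set0)) ?setI_eq0 // cards0.
  rewrite (cardsD1 u) inE ue uX leq_add2l.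
  rewrite (bigD1 u) //= -[leqLHS]addn0 leq_add //.
  rewrite -sum1_card [leqLHS]big_mkcond [leqRHS]big_mkcond; apply: leq_sum => v _.
  by rewrite !inE ue; case: (v == u); case: (v \in X); case: (v \in inc e).
rewrite -natr_sum; move: leL leD; rewrite -!(ler_nat R) natrD => leL leD.
have K0 : 0 <= (#|X| ^ 2 * K)%:R :> R by rewrite ler0n.
by rewrite ler_norml; apply/andP; split; lra.
Qed.

Lemma pow_lipschitz (x y : nat) (p' : R) : 0 <= p' <= 1 ->
  `|(1 - p') ^+ x - (1 - p') ^+ y| <= p' * `|x%:R - y%:R|.
Proof.
move=> /andP[p0 p1].
wlog lexy : x y / (x <= y)%N.
  move=> h; case/orP: (leq_total x y) => le; first exact: h.
  by rewrite distrC [X in _ <= _ * X]distrC; apply: h.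
rewrite -(subnK lexy); set d := (y - x)%N.
rewrite natrD opprD addrCA addrN addr0 normrN normr_nat exprD.
rewrite -{1}[(1 - p') ^+ x]mul1r -mulrBl normrM (@le_trans _ _ (`|1 - (1 - p') ^+ d|)) //.
  by rewrite ler_piMr ?normr_ge0 // ger0_norm ?exprn_ge0 ?exprn_ile1 ?subr_ge0 // lerBlDr lerDl.
elim: d => [|d IHd]; first by rewrite expr0 subrr normr0 mulr0.
rewrite exprS (_ : 1 - _ = (1 - (1 - p') ^+ d) + p' * (1 - p') ^+ d); last by ring.
rewrite -[d.+1%:R]natr1 mulrDr mulr1 (le_trans (ler_normD _ _)) // lerD //.
rewrite ger0_norm ?mulr_ge0 ?exprn_ge0 ?subr_ge0 // ler_piMr //.
by rewrite exprn_ile1 ?subr_ge0 // lerBlDr lerDl.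
Qed.

Section Step.
Variables (i : nat) (eta : R).
Hypothesis eta0 : 0 <= eta.
Hypothesis IH : forall X : {set V}, X \subset V0 -> (#|X| <= (2 * g).-1)%N ->
  `|P i X - q i ^+ (#|X|)| <= eta.

Let m := Num.truncn (D%:R * q i ^+ g.-1).

(** Second-moment estimate. Two edges through [v] sharing no other vertex have a union of [2 g - 1]
    vertices, which is why [IH] reaches sets of that size; the other pairs number at most [D g K].
    With exact survival probabilities the main terms form [q (D q ^ (g - 1) - m) ^ 2], at most 1 by
    the truncation. *)
Lemma adeg_variance v : v \in V0 ->
  nrun inc p i (fun s => (v \in alive s)%:R * ((adeg (alive s) v)%:R - m%:R) ^+ 2) s0
  <= 1 + 4 * D%:R ^+ 2 * eta + (D * g * K)%:R.
Proof.
move=> vV.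
have [g1 g2 g3] : [/\ (0 < (2 * g).-1)%N, (g <= (2 * g).-1)%N & (2 * g).-1 = (g.-1 * 2).+1]%N.
  by clear -g_gt0; split; lia.
pose Ev := [set e | v \in inc e].
have cEv : #|Ev| = D by apply: rh_deg rh _ vV.
have inEv e : e \in Ev -> v \in inc e by rewrite inE.
have eadeg A : (adeg A v)%:R = \sum_(e in Ev) (inc e \subset A)%:R :> R.
  rewrite /adeg -sum1_card natr_sum big_mkcond [RHS]big_mkcond; apply: eq_bigr => e _.
  by rewrite !inE; case: (v \in _); case: (inc e \subset A).
have -> : nrun inc p i (fun s => (v \in alive s)%:R * ((adeg (alive s) v)%:R - m%:R) ^+ 2) s0
  = \sum_(e in Ev) \sum_(f in Ev) P i (inc e :|: inc f) - 2 * m%:R * (\sum_(e in Ev) P i (inc e))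
    + m%:R ^+ 2 * P i [set v].
  rewrite -mulNr -nrunZ -nrun_sum -nrunZ.
  under eq_bigr do rewrite -nrun_sum.
  rewrite -nrun_sum -!nrunD; apply: eq_nrun => s.
  have -> : \sum_(e in Ev) \sum_(f in Ev) (inc e :|: inc f \subset alive s)%:R = (adeg (alive s) v)%:R ^+ 2 :> R.
    rewrite expr2 eadeg mulr_suml; apply: eq_bigr => e _.
    by rewrite mulr_sumr; apply: eq_bigr => f _; rewrite subUset -natrM mulnb.
  rewrite -eadeg sub1set; case: (boolP (v \in alive s)) => /= [_|vN]; first by ring.
  rewrite [adeg _ _]eq_card0; first by ring.
  by move=> e; rewrite inE; apply/negP => /andP[ve /subsetP/(_ v ve)]; apply/negP.
set Q := q i; have /andP[Q0 Q1] : 0 <= Q <= 1 by apply: survival01.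
have subV e : inc e \subset V0 by apply: rh_sub rh e.
have cinc e : #|inc e| = g by apply: rh_card rh e.
have P1 : P i [set v] <= Q + eta.
  have := IH (X := [set v]); rewrite sub1set vV cards1 expr1 => /(_ isT).
  by rewrite ler_distl => h; case/andP: (h g1) => _.
have Pe e : Q ^+ g - eta <= P i (inc e).
  by have := IH (subV e); rewrite cinc ler_distl => h; case/andP: (h g2).
have Pef e f : e \in Ev -> f \in Ev ->
    P i (inc e :|: inc f) <= Q ^+ (2 * g).-1 + eta + (\sum_(u in inc e | u != v) (u \in inc f))%:R.
  move=> /inEv ve /inEv vf.
  have c2 := cardsUI (inc e) (inc f); rewrite !cinc in c2.
  have cI : (0 < #|inc e :&: inc f|)%N by rewrite card_gt0; apply/set0Pn; exists v; rewrite inE ve.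
  have le2 : (#|inc e :|: inc f| <= (2 * g).-1)%N by clear -c2 cI; lia.
  have := IH (X := inc e :|: inc f); rewrite subUset !subV => /(_ isT le2).
  rewrite ler_distl => /andP[_ h]; apply: le_trans h _; rewrite addrAC lerD2r.
  have [e2|ne2] := eqVneq #|inc e :|: inc f| (2 * g).-1.
    by rewrite e2 lerDl ler0n.
  apply: (@le_trans _ _ 1); first by rewrite exprn_ile1.
  rewrite -[leLHS]add0r lerD ?exprn_ge0 // ler1n.
  have : (1 < #|inc e :&: inc f|)%N by clear -c2 cI ne2; lia.
  rewrite (cardsD1 v) inE ve vf ltnS card_gt0 => /set0Pn[u]; rewrite !inE => /and3P[uv ue uf].
  by rewrite (bigD1 u) ?ue //= uf.
have S2 : \sum_(e in Ev) \sum_(f in Ev) P i (inc e :|: inc f) <=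
    D%:R ^+ 2 * (Q ^+ (2 * g).-1 + eta) + (D * g * K)%:R.
  apply: (@le_trans _ _ (\sum_(e in Ev) (D%:R * (Q ^+ (2 * g).-1 + eta) + (g * K)%:R))).
    apply: ler_sum => e eEv.
    apply: le_trans (ler_sum _ (fun f fEv => Pef e f eEv fEv)) _.
    rewrite big_split /= sumr_const cEv -[_ *+ D]mulr_natl lerD2l -natr_sum ler_nat.
    rewrite exchange_big /= -(cinc e) -sum_nat_const.
    rewrite [leqLHS]big_mkcond [leqRHS]big_mkcond; apply: leq_sum => u _.
    case: (u \in inc e) => //=; case: eqP => //= /eqP uv.
    apply: leq_trans (rh_codeg rh uv); rewrite -sum1_card [leqLHS]big_mkcond [leqRHS]big_mkcond.
    by apply: leq_sum => f _; rewrite !inE andbC; case: (v \in _); case: (u \in _).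
  rewrite sumr_const cEv -[_ *+ D]mulr_natl mulrDr -natrM mulnA.
  by rewrite expr2 mulrA.
have S1 : D%:R * (Q ^+ g - eta) <= \sum_(e in Ev) P i (inc e).
  rewrite -{1}cEv mulr_natl -sumr_const; apply: ler_sum => e _; exact: Pe.
have /andP[m1 m2] : m%:R <= D%:R * Q ^+ g.-1 < m.+1%:R.
  by apply: truncn_itv; rewrite mulr_ge0 ?exprn_ge0 ?ler0n.
have mD : m%:R <= D%:R :> R.
  by apply: le_trans m1 _; rewrite ler_piMr ?ler0n // exprn_ile1.
have eQ1 : Q ^+ g = Q * Q ^+ g.-1 by rewrite -exprS prednK.
have eQ2 : Q ^+ (2 * g).-1 = Q * (Q ^+ g.-1) ^+ 2.
  by rewrite -exprM -exprS g3.
rewrite eQ1 in S1; rewrite eQ2 in S2; rewrite -natr1 in m2.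
have D0 : 0 <= D%:R :> R by rewrite ler0n.
have m0 : 0 <= m%:R :> R by rewrite ler0n.
set y := Q ^+ g.-1 in m1 m2 S1 S2 *.
set GK := (D * g * K)%:R in S2 *.
have sq : Q * (D%:R * y - m%:R) ^+ 2 <= 1.
  by rewrite mulr_ile1 ?sqr_ge0 ?exprn_ile1 // ?subr_ge0 //; lra.
have t1 : m%:R * (D%:R * (Q * y - eta)) <= m%:R * \sum_(e in Ev) P i (inc e).
  by rewrite ler_wpM2l.
have t2 : m%:R ^+ 2 * P i [set v] <= m%:R ^+ 2 * (Q + eta) by rewrite ler_wpM2l ?sqr_ge0.
have t3 : m%:R * D%:R * eta <= D%:R ^+ 2 * eta by rewrite ler_wpM2r // expr2 ler_wpM2r.
have t4 : m%:R ^+ 2 * eta <= D%:R ^+ 2 * eta.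
  by rewrite ler_wpM2r // !expr2 ler_pM.
lra.
Qed.

End Step.

End NibbleRound.

Section NibbleStep.
Variables (R : archiRealFieldType) (V E : finType) (inc : E -> {set V}).
Variables (V0 : {set V}) (g D K : nat) (eps : R).
Hypotheses (g_gt0 : (0 < g)%N) (D_gt0 : (0 < D)%N) (eps01 : 0 <= eps <= 1).
Hypothesis rh : regular_hypergraph inc V0 g D K.

Let p : R := eps / D%:R.
Let q := survival g D eps.
Let s0 : nstate V E := NState V0 set0 set0.
Let P i (X : {set V}) := nrun inc p i (fun s => (X \subset alive s)%:R) s0.

Section Step.
Variables (i : nat) (eta : R).
Hypothesis eta0 : 0 <= eta.
Hypothesis IH : forall X : {set V}, X \subset V0 -> (#|X| <= (2 * g).-1)%N ->
  `|P i X - q i ^+ (#|X|)| <= eta.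

Let m := Num.truncn (D%:R * q i ^+ g.-1).

(** Given the state, [X] survives the round with probability [1 - p] to the number of live edges
    meeting it; this exponent is compared with [m |X|]. The parameter [kappa] trades the absolute
    degree error for its square by AM-GM. *)
Lemma alive_step (kappa : R) (X : {set V}) : 0 < kappa -> X \subset V0 ->
  (#|X| <= (2 * g).-1)%N ->
  `|P i.+1 X - q i.+1 ^+ (#|X|)| <=
   eta + eps * (#|X| ^ 2)%:R * (K%:R / D%:R) +
   eps * #|X|%:R * (((D%:R ^+ 2)^-1 + 4 * eta + g%:R * (K%:R / D%:R)) / (2 * kappa) + kappa / 2).
Proof.
move=> k0 XV X2.
have D0 : 0 < D%:R :> R by rewrite ltr0n.
have p01 := pick_prob01 D_gt0 eps01.
have /andP[p0 p1] := p01.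
have {}p0 : 0 <= p by [].
have {}p1 : p <= 1 by [].
have e0 : 0 <= eps by case/andP: eps01.
pose f1 (s : nstate V E) : R := (X \subset alive s)%:R *
   ((1 - p) ^+ (#|nhit inc (alive s) X|) - (1 - p) ^+ (m * #|X|)).
have eP : P i.+1 X - q i.+1 ^+ (#|X|) =
   nrun inc p i f1 s0 + (1 - p) ^+ (m * #|X|) * (P i X - q i ^+ (#|X|)).
  have -> : q i.+1 ^+ (#|X|) = q i ^+ (#|X|) * (1 - p) ^+ (m * #|X|).
    by rewrite /q /= exprMn exprM.
  have -> : P i.+1 X = nrun inc p i f1 s0 + (1 - p) ^+ (m * #|X|) * P i X.
    rewrite -nrunZ -nrunD {1}/P [LHS]/=; apply: eq_nrun => s.
    rewrite rsub_alive /f1; ring.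
  ring.
have pX01 : 0 <= (1 - p) ^+ (m * #|X|) <= 1.
  by rewrite exprn_ge0 ?exprn_ile1 ?subr_ge0 // lerBlDr lerDl.
rewrite eP (le_trans (ler_normD _ _)) // addrC -addrA lerD //.
  rewrite normrM ger0_norm; last by case/andP: pX01.
  apply: le_trans (IH XV X2); rewrite ler_piMl ?normr_ge0 //; by case/andP: pX01.
pose f2 (s : nstate V E) : R := p * (#|X| ^ 2 * K)%:R +
  \sum_(v in X) (p / (2 * kappa * D%:R) * ((v \in alive s)%:R * ((adeg inc (alive s) v)%:R - m%:R) ^+ 2)
                 + p * (kappa * D%:R / 2)).
have f12 s : `|f1 s| <= f2 s.
  rewrite /f1 /f2; case: (boolP (X \subset alive s)) => XA; last first.
    have kd0 : 0 <= kappa * D%:R by rewrite mulr_ge0 ?ler0n // ltW.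
    rewrite mul0r normr0; apply: addr_ge0; first by rewrite mulr_ge0 ?ler0n.
    apply: sumr_ge0 => v _; apply: addr_ge0.
      apply: mulr_ge0; last by rewrite mulr_ge0 ?ler0n ?sqr_ge0.
      by rewrite divr_ge0 // -mulrA mulr_ge0 ?ler0n.
    by rewrite mulr_ge0 // divr_ge0 ?ler0n.
  rewrite mul1r (le_trans (pow_lipschitz _ _ _)) ?p0 //.
  set L := #|nhit inc (alive s) X|.
  apply: (@le_trans _ _ (p * ((#|X| ^ 2 * K)%:R + \sum_(v in X) `|(adeg inc (alive s) v)%:R - m%:R|))).
    rewrite ler_wpM2l //.
    have -> : L%:R - (m * #|X|)%:R = (L%:R - \sum_(v in X) (adeg inc (alive s) v)%:R) +
        \sum_(v in X) ((adeg inc (alive s) v)%:R - m%:R) :> R.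
      rewrite sumrB sumr_const -[m%:R *+ _]mulr_natr -natrM; ring.
    by rewrite (le_trans (ler_normD _ _)) // lerD ?(nhit_adeg R rh) // ler_norm_sum.
  rewrite mulrDr lerD2l mulr_sumr; apply: ler_sum => v vX.
  rewrite (subsetP XA) // mul1r -mulrA -mulrDr ler_wpM2l //.
  set y := _ - _; rewrite -[y ^+ 2](real_normK (num_real y)).
  have c0 : 0 < kappa * D%:R by rewrite mulr_gt0.
  rewrite -[2 * kappa * _]mulrA; set c := kappa * D%:R in c0 *.
  have -> : (2 * c)^-1 * `|y| ^+ 2 + c / 2 = (`|y| ^+ 2 + c ^+ 2) / (2 * c).
    by field; rewrite gt_eqF.
  rewrite ler_pdivlMr ?mulr_gt0 //.
  have := sqr_ge0 (`|y| - c); lra.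
have nle : `|nrun inc p i f1 s0| <= nrun inc p i f2 s0.
  rewrite ler_norml -[- nrun _ _ _ f2 _]mulN1r -nrunZ; apply/andP; split.
    apply: nrun_le => // s; rewrite mulN1r; have := f12 s; rewrite ler_norml => /andP[]; done.
  by apply: nrun_le => // s; apply: le_trans (ler_norm _) (f12 s).
apply: le_trans nle _.
rewrite nrunD nrun_cst nrun_sum lerD //.
  by rewrite natrM /p le_eqVlt; apply/orP; left; apply/eqP; field; rewrite gt_eqF.
apply: (@le_trans _ _ (\sum_(v in X)
    (eps * (((D%:R ^+ 2)^-1 + 4 * eta + g%:R * (K%:R / D%:R)) / (2 * kappa) + kappa / 2)))).
  apply: ler_sum => v vX; rewrite nrunD nrunZ nrun_cst.
  have vV := subsetP XV v vX.
  apply: (@le_trans _ _ (p / (2 * kappa * D%:R) * (1 + 4 * D%:R ^+ 2 * eta + (D * g * K)%:R) +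
      p * (kappa * D%:R / 2))).
    rewrite lerD2r ler_wpM2l ?(adeg_variance g_gt0 D_gt0 eps01 rh eta0 IH) //.
    by rewrite !mulr_ge0 ?invr_ge0 ?mulr_ge0 ?ler0n ?(ltW k0).
  rewrite !natrM /p le_eqVlt; apply/orP; left; apply/eqP; field.
  by rewrite !gt_eqF.
by rewrite sumr_const -[_ *+ #|X|]mulr_natl mulrCA mulrA le_refl.
Qed.

End Step.

End NibbleStep.

(** Iterates [alive_step]. The threshold [b] is uniform over all hypergraphs. *)
Lemma alive_close (R : archiRealFieldType) (g : nat) (eps : R) :
  (0 < g)%N -> 0 <= eps <= 1 -> forall (i : nat) (eta : R), 0 < eta ->
  exists2 b : R, 0 < b &
  forall (V E : finType) (inc : E -> {set V}) (V0 : {set V}) (D K : nat),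
    (0 < D)%N -> regular_hypergraph inc V0 g D K ->
    D%:R^-1 <= b -> K%:R / D%:R <= b ->
    forall X : {set V}, X \subset V0 -> (#|X| <= (2 * g).-1)%N ->
    `|nrun inc (eps / D%:R) i (fun s => (X \subset alive s)%:R) (NState V0 set0 set0)
      - survival g D eps i ^+ (#|X|)| <= eta.
Proof.
move=> g0 eps01; elim=> [|i IHi] eta eta0.
  exists 1 => // V E inc V0 D K _ _ _ _ X XV _ /=.
  by rewrite XV expr1n subrr normr0 ltW.
have [G G0 GX] : exists2 G : R, 0 < G & forall n, (n <= (2 * g).-1)%N -> n%:R <= G.
  exists (2 * g)%:R; first by rewrite ltr0n muln_gt0.
  by move=> n nle; rewrite ler_nat; apply: leq_trans nle (leq_pred _).
(* The second moment gets divided by [kappa], of order [eta / G], so the previous round must be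
   accurate to order [eta ^ 2]. *)
pose eta' := Num.min (eta / 8) (eta ^+ 2 / (32 * G ^+ 2)).
have eta'0 : 0 < eta'.
  by rewrite lt_min !divr_gt0 ?mulr_gt0 ?exprn_gt0.
have [b0 b00 Hb0] := IHi eta' eta'0.
pose b := Num.min b0 (Num.min (eta / (8 * G ^+ 2)) (eta ^+ 2 / (8 * G ^+ 2 * (1 + g%:R)))).
have gp : 0 < 1 + g%:R :> R by rewrite ltr_wpDr ?ler0n.
exists b.
  by rewrite !lt_min b00 !divr_gt0 ?mulr_gt0 ?exprn_gt0.
move=> V E inc V0 D K D0 rh Db Kb X XV X2.
have [bb0 bb1 bb2] : [/\ b <= b0, b <= eta / (8 * G ^+ 2) & b <= eta ^+ 2 / (8 * G ^+ 2 * (1 + g%:R))].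
  by rewrite /b !ge_min !lexx !orbT.
have IH := Hb0 V E inc V0 D K D0 rh (le_trans Db bb0) (le_trans Kb bb0).
pose kappa := eta / (2 * G).
have k0 : 0 < kappa by rewrite divr_gt0 ?mulr_gt0.
apply: le_trans (alive_step g0 D0 eps01 rh (ltW eta'0) IH k0 XV X2) _.
have [e1 e2] : eta' <= eta / 8 /\ eta' <= eta ^+ 2 / (32 * G ^+ 2).
  by rewrite /eta' !ge_min !lexx !orbT.
have xG := GX _ X2.
have x0 : 0 <= #|X|%:R :> R by rewrite ler0n.
case/andP: eps01 => ep0 ep1.
set kd := K%:R / D%:R in Kb *.
have kd0 : 0 <= kd by rewrite divr_ge0 ?ler0n.
have b_0 : 0 <= b by apply: le_trans kd0 Kb.
have D2 : (D%:R ^+ 2)^-1 <= b.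
  apply: le_trans Db; rewrite lef_pV2 ?posrE ?exprn_gt0 ?ltr0n //.
  by rewrite expr2 ler_peMl ?ler0n // ler1n.
set d2 := _^-1 in D2 *.
have d20 : 0 <= d2 by rewrite invr_ge0 exprn_ge0 ?ler0n.
have A1 : eps * (#|X| ^ 2)%:R * kd <= eta / 8.
  apply: (@le_trans _ _ (1 * G ^+ 2 * b)).
    apply: ler_pM => //; first by rewrite mulr_ge0 ?ler0n.
    by apply: ler_pM => //; rewrite ?ler0n // natrX !expr2 ler_pM.
  have := ler_wpM2l (ltW (exprn_gt0 2 G0)) bb1; rewrite mul1r.
  rewrite (_ : G ^+ 2 * (eta / (8 * G ^+ 2)) = eta / 8) //.
  by field; rewrite gt_eqF.
set Z := (d2 + 4 * eta' + g%:R * kd) / (2 * kappa) + kappa / 2.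
have Zle : Z <= eta ^-1 * G * ((1 + g%:R) * b + 4 * eta') + eta / (4 * G).
  rewrite /Z; apply: lerD; last first.
    rewrite /kappa le_eqVlt; apply/orP; left; apply/eqP; field.
    by rewrite gt_eqF.
  rewrite (_ : (2 * kappa)^-1 = eta^-1 * G); last first.
    by rewrite /kappa; field; rewrite !gt_eqF.
  rewrite mulrC ler_wpM2l ?mulr_ge0 ?invr_ge0 ?(ltW eta0) ?(ltW G0) //.
  have : g%:R * kd <= g%:R * b by rewrite ler_wpM2l ?ler0n.
  lra.
have Z0 : 0 <= Z.
  have g00 : 0 <= g%:R :> R by rewrite ler0n.
  have k00 := ltW k0; have eta'00 := ltW eta'0.
  have N0 : 0 <= d2 + 4 * eta' + g%:R * kd.
    by apply: addr_ge0; [apply: addr_ge0 => //|]; apply: mulr_ge0; rewrite ?ler0n.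
  by apply: addr_ge0; apply: divr_ge0; rewrite ?ler0n //; apply: mulr_ge0; rewrite ?ler0n.
have A2 : eps * #|X|%:R * Z <= G * Z.
  by rewrite -[G]mul1r; apply: ler_pM => //; rewrite ?mulr_ge0 // ler_pM.
have A3 : G * Z <= eta / 2.
  apply: le_trans (ler_wpM2l (ltW G0) Zle) _.
  have t1 : G ^+ 2 / eta * (1 + g%:R) * b <= eta / 8.
    have c0 : 0 <= G ^+ 2 / eta * (1 + g%:R) by rewrite !mulr_ge0 ?invr_ge0 ?exprn_ge0 ?ltW.
    apply: le_trans (ler_wpM2l c0 bb2) _.
    rewrite le_eqVlt; apply/orP; left; apply/eqP; field.
    by rewrite !gt_eqF.
  have t2 : G ^+ 2 / eta * 4 * eta' <= eta / 8.
    have c0 : 0 <= G ^+ 2 / eta * 4 by rewrite !mulr_ge0 ?invr_ge0 ?exprn_ge0 ?ltW.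
    apply: le_trans (ler_wpM2l c0 e2) _.
    rewrite le_eqVlt; apply/orP; left; apply/eqP; field.
    by rewrite !gt_eqF.
  have -> : G * (eta^-1 * G * ((1 + g%:R) * b + 4 * eta') + eta / (4 * G)) =
    G ^+ 2 / eta * (1 + g%:R) * b + G ^+ 2 / eta * 4 * eta' + eta / 4.
    by field; rewrite !gt_eqF.
  lra.
lra.
Qed.

Section SurvivalSum.
Variables (R : archiRealFieldType) (g D : nat) (eps : R).
Hypotheses (g_gt0 : (0 < g)%N) (D_gt0 : (0 < D)%N) (eps01 : 0 <= eps <= 1).

Lemma survival_step i :
  survival g D eps i - survival g D eps i.+1 <= eps * survival g D eps i ^+ g.
Proof.
have /andP[q0 q1] := survival01 g D_gt0 eps01 i.
have p01 := pick_prob01 D_gt0 eps01; case/andP: eps01 => e0 e1.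
set q := survival g D eps i in q0 q1 *.
rewrite -[survival g D eps i.+1]/(q * _); set m := Num.truncn _.
rewrite -{1}[q]mulr1 -mulrBr -[X in _ <= _ * _ ^+ X](prednK g_gt0) exprS mulrCA ler_wpM2l //.
have := pow_lipschitz 0 m p01; rewrite expr0 sub0r normrN normr_nat => /(le_trans (ler_norm _)) h.
apply: le_trans h _; rewrite -mulrA ler_wpM2l // ler_pdivrMl ?ltr0n //.
have /andP[] : m%:R <= D%:R * q ^+ g.-1 < m.+1%:R.
  by apply: truncn_itv; rewrite mulr_ge0 ?exprn_ge0 ?ler0n.
by [].
Qed.

Lemma survival_antimono i j : (i <= j)%N -> survival g D eps j <= survival g D eps i.
Proof.
elim: j => [|j IHj]; first by rewrite leqn0 => /eqP->.
rewrite leq_eqVlt ltnS => /predU1P[->//|/IHj]; apply: le_trans => /=.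
have /andP[q0 _] := survival01 g D_gt0 eps01 j.
have /andP[p0 p1] := pick_prob01 D_gt0 eps01.
by rewrite ler_piMr // exprn_ile1 ?subr_ge0 // lerBlDr lerDl.
Qed.

(** Either the survival probability falls below [theta] within [T] rounds, and [survival_step]
    telescopes to [1 - theta]; or it stays above, and [T] terms of size at least [eps theta ^ g] sum
    to at least 1. *)
Lemma survival_sum (theta : R) T : 0 < theta <= 1 -> 1 <= T%:R * (eps * theta ^+ g) ->
  1 - theta <= \sum_(i < T) eps * survival g D eps i ^+ g.
Proof.
move=> /andP[th0 th1] T1; case/andP: eps01 => e0 e1.
have [lt|ge] := ltP (survival g D eps T) theta.
  apply: (@le_trans _ _ (1 - survival g D eps T)); first by rewrite lerD2l lerN2 ltW.
  rewrite -(big_mkord xpredT (fun i => eps * survival g D eps i ^+ g)).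
  elim: T {T1 lt} => [|T IHT]; first by rewrite big_nil subrr.
  by rewrite big_nat_recr //; have := survival_step T; move: IHT; rewrite [X in _ <= _ + X]/=; lra.
apply: (@le_trans _ _ 1); first by rewrite lerBlDr lerDl ltW.
apply: le_trans T1 _; rewrite mulr_natl -[T in leLHS]card_ord -sumr_const.
apply: ler_sum => i _; rewrite ler_wpM2l // lerXn2r ?nnegrE ?(ltW th0) //.
  by apply: le_trans (ltW th0) _; apply: le_trans ge (survival_antimono (ltnW (ltn_ord i))).
by apply: le_trans ge (survival_antimono (ltnW (ltn_ord i))).
Qed.

End SurvivalSum.

(** Adds up the expected gains of the rounds; double counting of incidences, [|E| g = |V0| D],
    replaces edges by vertices. *)
Lemma nrun_matched (R : archiRealFieldType) (V E : finType) (inc : E -> {set V})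
    (V0 : {set V}) (g D K : nat) (eps : R) (T : nat) (eta : R) :
  (0 < g)%N -> (0 < D)%N -> 0 <= eps <= 1 -> eps * g%:R <= 1 ->
  regular_hypergraph inc V0 g D K ->
  let P i (X : {set V}) := nrun inc (eps / D%:R) i (fun s => (X \subset alive s)%:R)
            (NState V0 set0 set0) in
  (forall i e, (i < T)%N -> survival g D eps i ^+ g - eta <= P i (inc e)) ->
  #|V0|%:R / g%:R * (1 - eps * g%:R) *
    \sum_(i < T) eps * (survival g D eps i ^+ g - eta)
  <= nrun inc (eps / D%:R) T (fun s => #|matched s|%:R) (NState V0 set0 set0).
Proof.
move=> g0 D0 eps01 eg1 rh P HP.
have p01 := pick_prob01 D0 eps01.
have D_0 : 0 < D%:R :> R by rewrite ltr0n.
have g_0 : 0 < g%:R :> R by rewrite ltr0n.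
have /andP[e0 e1] := eps01.
have m0 : nmatching inc (alive (NState V0 (set0 : {set E}) set0)) (matched (NState V0 set0 (set0 : {set E}))).
  by apply/forall_inP => e; rewrite inE.
have cE : #|E|%:R * g%:R = #|V0|%:R * D%:R :> R.
  rewrite -!natrM; congr _%:R.
  rewrite -sum_nat_const -[LHS]sum_nat_const.
  transitivity (\sum_(v in V0) #|[set e | v \in inc e]|)%N; last by apply: eq_bigr => v /(rh_deg rh).
  transitivity (\sum_e \sum_(v in V0) (v \in inc e))%N.
    apply: eq_bigr => e _; rewrite -(rh_card rh e) -sum1_card big_mkcond [RHS]big_mkcond /=.
    apply: eq_bigr => v _; case: (boolP (v \in inc e)) => [/(subsetP (rh_sub rh e))->//|_].
    by case: ifP.
  rewrite exchange_big /=; apply: eq_bigr => v _; rewrite -sum1_card big_mkcond [RHS]big_mkcond /=.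
  by apply: eq_bigr => e _; rewrite inE; case: (v \in _).
rewrite -(big_mkord xpredT (fun i => eps * (survival g D eps i ^+ g - eta))).
elim: T HP => [|T IHT] HP.
  by rewrite big_nil mulr0 /= cards0.
rewrite big_nat_recr // mulrDr.
have step := @nrun_le_inv R V E inc (eps / D%:R) p01 (fun s => nmatching inc (alive s) (matched s)) T
  (fun s => #|matched s|%:R + (eps / D%:R) * #|live inc (alive s) setT|%:R * (1 - (eps / D%:R) * (g * D)%:R))
  (fun s => rsub (eps / D%:R) (fun S => #|matched (nstep inc S s)|%:R)) (NState V0 set0 set0) m0.
apply: le_trans (step _ _); last 2 first.
- by move=> s S; apply: nstep_matching.
- move=> s ms; apply: rsub_matched => //; first exact: rh_card rh.
  exact: deg_le rh.
rewrite nrunD lerD //; first by apply: IHT => i e iT; apply: HP; rewrite ltnS ltnW.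
have -> : nrun inc (eps / D%:R) T (fun s => eps / D%:R * #|live inc (alive s) [set: E]|%:R *
   (1 - eps / D%:R * (g * D)%:R)) (NState V0 set0 set0) =
   (eps / D%:R * (1 - eps * g%:R)) * \sum_e P T (inc e).
  rewrite -nrun_sum -nrunZ; apply: eq_nrun => s.
  rewrite natr_card; under eq_bigr do rewrite inE in_setT /=.
  rewrite natrM; set Z := \sum_i _; rewrite (_ : eps / D%:R * (g%:R * D%:R) = eps * g%:R); first ring.
  by field; rewrite gt_eqF.
apply: (@le_trans _ _ (eps / D%:R * (1 - eps * g%:R) * (#|E|%:R * (survival g D eps T ^+ g - eta)))); last first.
  rewrite ler_wpM2l //; first by rewrite mulr_ge0 ?subr_ge0 //; case/andP: p01.
  rewrite mulr_natl -sumr_const; apply: ler_sum => e _; exact: HP.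
have -> : #|E|%:R = #|V0|%:R * D%:R / g%:R :> R by rewrite -cE mulfK // gt_eqF.
rewrite le_eqVlt; apply/orP; left; apply/eqP; field.
by rewrite !gt_eqF.
Qed.

(* Rödl nibble: [T] rounds, in each of which every edge is picked independently with probability
   [eps / D]; the factor [(c / D) ^ |B|] bounds the probability that all edges of [B] get picked. *)
Theorem nibble (R : archiRealFieldType) (g : nat) (delta : R) :
  (0 < g)%N -> 0 < delta ->
  exists2 cb : R * R, 0 < cb.1 /\ 0 < cb.2 &
  forall (V E : finType) (inc : E -> {set V}) (V0 : {set V}) (D K : nat)
    (BB : {set {set E}}),
    (0 < D)%N -> regular_hypergraph inc V0 g D K ->
    D%:R^-1 <= cb.2 -> K%:R / D%:R <= cb.2 -> set0 \notin BB ->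
  exists M : {set E}, [/\
    forall e f, e \in M -> f \in M -> e != f -> [disjoint inc e & inc f],
    forall B, B \in BB -> ~~ (B \subset M) &
    #|V0|%:R / g%:R * (1 - delta) - \sum_(B in BB) (cb.1 / D%:R) ^+ (#|B|) <= #|M|%:R].
Proof.
move=> g0.
wlog delta1 : delta / delta <= 1.
  move=> h delta0; have [|gt] := leP delta 1; first by move=> le; apply: h.
  have [cb cb0 H] := h 1 (lexx _) ltr01; exists cb => // V E inc V0 D K BB D0 rh Db Kb BB0.
  have [M [M1 M2 M3]] := H V E inc V0 D K BB D0 rh Db Kb BB0; exists M; split=> //.
  apply: le_trans M3; rewrite lerD2r ler_wpM2l ?divr_ge0 ?ler0n //.
  by rewrite lerD2l lerN2 ltW.
move=> delta0.
have g_0 : 0 < g%:R :> R by rewrite ltr0n.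
have g_1 : 1 <= g%:R :> R by rewrite ler1n.
(* Three losses of at most [delta / 4] each: collisions within a round ([eps g]), vertices left
   alive ([th]), and the accumulated deviation from the idealised survival ([T eps eta]). *)
pose th := delta / 4; pose eps := delta / (4 * g%:R).
have th0 : 0 < th by rewrite divr_gt0.
have eg : eps * g%:R = delta / 4 by rewrite /eps; field; rewrite gt_eqF.
have eps0 : 0 < eps by rewrite divr_gt0 // mulr_gt0.
have eps1 : eps <= 1 by nra.
have eps01 : 0 <= eps <= 1 by rewrite ltW.
have [T T1] : exists T : nat, 1 <= T%:R * (eps * th ^+ g).
  exists (Num.truncn (eps * th ^+ g)^-1).+1.
  rewrite -ler_pdivrMr ?div1r; last by apply: mulr_gt0 => //; apply: exprn_gt0.
  have /andP[_ /ltW//] : (Num.truncn (eps * th ^+ g)^-1)%:R <=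
      (eps * th ^+ g)^-1 < (Num.truncn (eps * th ^+ g)^-1).+1%:R.
  by apply: truncn_itv; rewrite invr_ge0 mulr_ge0 ?exprn_ge0 // ltW.
pose eta := delta / (4 * (T%:R * eps + 1)).
have Te0 : 0 <= T%:R * eps by rewrite mulr_ge0 ?ler0n // ltW.
have eta0 : 0 < eta by rewrite divr_gt0 // mulr_gt0 // ltr_wpDl.
have Teeta : T%:R * eps * eta <= delta / 4.
  rewrite /eta; move: (T%:R * eps) Te0 => X X0.
  have X1 : 0 < X + 1 by rewrite ltr_wpDl.
  rewrite (_ : X * _ = delta / 4 * (X / (X + 1))); last by field; rewrite gt_eqF.
  by rewrite ler_piMr ?divr_ge0 ?ler0n ?(ltW delta0) // ler_pdivrMr ?mul1r ?lerDl.
have [b b0 Hb] : exists2 b : R, 0 < b & forall i, (i < T)%N ->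
  forall (V E : finType) (inc : E -> {set V}) (V0 : {set V}) (D K : nat),
    (0 < D)%N -> regular_hypergraph inc V0 g D K ->
    D%:R^-1 <= b -> K%:R / D%:R <= b ->
    forall X : {set V}, X \subset V0 -> (#|X| <= (2 * g).-1)%N ->
    `|nrun inc (eps / D%:R) i (fun s => (X \subset alive s)%:R) (NState V0 set0 set0)
      - survival g D eps i ^+ (#|X|)| <= eta.
  elim: (T) => [|T' [b b0 IH]]; first by exists 1.
  have [b' b'0 H] := alive_close g0 eps01 T' eta0.
  exists (Num.min b b'); first by rewrite lt_min b0.
  move=> i; rewrite ltnS leq_eqVlt => iT V E inc V0 D K D0 rh.
  rewrite !le_min => /andP[D1 D2] /andP[K1 K2].
  by case/predU1P: iT => [->|iT]; [exact: (H _ _ _ _ _ K) | exact: (IH i iT _ _ _ _ _ K)].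
exists (T%:R * eps + 1, b); first by rewrite ltr_wpDl.
move=> V E inc V0 D K BB D0 rh Db Kb BB0 /=.
pose s0 : nstate V E := NState V0 set0 set0.
pose p := eps / D%:R.
have p01 : 0 <= p <= 1 by apply: pick_prob01.
(* The penalty refers to [picked], which contains the matching and whose law is bounded by
   [nrun_picked]. *)
pose f (s : nstate V E) : R := #|matched s|%:R - \sum_(B in BB) (B \subset picked s)%:R.
have := @nrun_exists R V E inc p p01 
  (fun s => nmatching inc (alive s) (matched s) /\ matched s \subset picked s) T f s0.
case.
- by split; rewrite ?sub0set //; apply/forall_inP => e; rewrite inE.
- move=> s S [h1 h2]; split; first exact: nstep_matching.
  rewrite /= subUset !(subset_trans h2) ?subsetUl //= (subset_trans _ (subsetUr _ _)) //.
  by apply/subsetP => e; rewrite !inE => /andP[/andP[]].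
move=> s [sm sp] fs.
have [M [Ms MB cM]] := delete_bad (matched s) BB0.
exists M; split=> //.
  move=> e h /(subsetP Ms) eM /(subsetP Ms) hM eh.
  have /andP[_ /forall_inP/(_ h hM)/implyP] := forall_inP sm e eM.
  by apply; rewrite eq_sym.
set BM := [set B in BB | _] in cM.
have cBM : #|BM|%:R <= \sum_(B in BB) (B \subset picked s)%:R :> R.
  rewrite natr_card [leRHS]big_mkcond; apply: ler_sum => B _.
  rewrite inE; case: (B \in BB) => //=; rewrite ler_nat.
  by case: (boolP (B \subset matched s)) => // Bm; rewrite (subset_trans Bm sp).
have fM : f s <= #|M|%:R.
  rewrite /f lerBlDr; apply: le_trans (_ : #|matched s|%:R <= #|M|%:R + #|BM|%:R) _.
    by rewrite -natrD ler_nat.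
  by rewrite lerD2l.
apply: le_trans fM; apply: le_trans fs.
rewrite [leRHS](_ : _ = nrun inc p T (fun s => #|matched s|%:R) s0 -
  \sum_(B in BB) nrun inc p T (fun s => (B \subset picked s)%:R) s0); last first.
  rewrite -nrun_sum -mulN1r -nrunZ -nrunD; apply: eq_nrun => s'.
  by rewrite mulN1r.
apply: lerB; last first.
  apply: ler_sum => B _; apply: le_trans (nrun_picked inc p01 B T _) _ => //.
  have h1 : 0 <= T%:R * p by rewrite mulr_ge0 ?ler0n //; case/andP: p01.
  have h2 : T%:R * p <= (T%:R * eps + 1) / D%:R.
    by rewrite /p mulrA ler_wpM2r ?invr_ge0 ?ler0n // lerDl.
  by rewrite lerXn2r ?nnegrE // (le_trans h1).
have eg1 : eps * g%:R <= 1 by rewrite eg; lra.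
have HPe i e : (i < T)%N -> survival g D eps i ^+ g - eta <=
    nrun inc (eps / D%:R) i (fun s => (inc e \subset alive s)%:R) s0.
  move=> iT; have := Hb i iT V E inc V0 D K D0 rh Db Kb (inc e) (rh_sub rh e).
  rewrite (rh_card rh); have -> : (g <= (2 * g).-1)%N by clear -g0; lia.
  by move=> /(_ isT); rewrite ler_distl => /andP[].
have := nrun_matched g0 D0 eps01 eg1 rh HPe; rewrite eg; apply: le_trans.
rewrite -[leRHS]mulrA ler_wpM2l ?divr_ge0 ?ler0n //.
have S1 := survival_sum g0 D0 eps01 (theta := th) (T := T).
have : 1 - th <= \sum_(i < T) eps * survival g D eps i ^+ g.
  by apply: S1 => //; rewrite th0 /= /th; nra.
have -> : \sum_(i < T) eps * (survival g D eps i ^+ g - eta) =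
  \sum_(i < T) eps * survival g D eps i ^+ g - T%:R * eps * eta.
  under eq_bigr do rewrite mulrBr.
  by rewrite sumrB sumr_const card_ord -mulrA mulr_natl.
set Z := \sum_(i < T) _; rewrite /th => Z1.
nra.
Qed.

Local Close Scope ring_scope.

(** * Gadgets with small shadow *)

Section Span.
Variables (X0 Y W P0 : finType) (iota : P0 -> W -> X0).
Implicit Types (c : P0 * {ffun W -> Y}) (B : {set P0 * {ffun W -> Y}}).

(** The graph of [c.2] with first coordinates placed by [c.1]. It serves twice: with a single
    trivial placement for gadget edges, and for copies of [W] in the blow-up of a host. *)
Definition cgraph c : {set X0 * Y} := [set (iota c.1 j, c.2 j) | j in W].

Definition span B := \bigcup_(c in B) cgraph c.

Lemma card_cgraph c : injective (iota c.1) -> #|cgraph c| = #|W|.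
Proof. by move=> inj; rewrite card_imset // => i j [/inj]. Qed.

(** A family is recovered from its placements, a table saying which of at most [u + 1] spanned
    points each coordinate uses, and the [Y]-components of these points. Only the last datum
    involves [Y]. *)
Lemma span_code (y0 : Y) B u : #|span B| <= u.+1 ->
  exists z : {ffun 'I_#|B| -> P0} * {ffun 'I_#|B| * W -> 'I_u.+1} * {ffun 'I_u.+1 -> Y},
  B = [set (z.1.1 i, [ffun j => z.2 (z.1.2 (i, j))]) | i in 'I_#|B|].
Proof.
move=> leu.
pose b (i : 'I_#|B|) := enum_val i.
pose x (ij : 'I_#|B| * W) := (iota (b ij.1).1 ij.2, (b ij.1).2 ij.2).
exists ([ffun i => (b i).1], [ffun ij => inord (index (x ij) (enum (span B)))],
        [ffun l : 'I_u.+1 => (nth y0 [seq v.2 | v <- enum (span B)] l)]).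
have eb i : ([ffun i => (b i).1] i, [ffun j => [ffun l : 'I_u.+1 => (nth y0 [seq v.2 | v <- enum (span B)] l)]
   ([ffun ij => inord (index (x ij) (enum (span B)))] (i, j))]) = b i.
  rewrite ffunE [RHS]surjective_pairing; congr pair.
  apply/ffunP => j; rewrite !ffunE.
  have xs : x (i, j) \in enum (span B).
    rewrite mem_enum; apply/bigcupP; exists (b i); first exact: enum_valP.
    by apply/imsetP; exists j.
  have lx : index (x (i, j)) (enum (span B)) < size (enum (span B)) by rewrite index_mem.
  rewrite inordK; last by apply: leq_trans lx _; rewrite -cardE.
  by rewrite (nth_map (x (i, j))) // nth_index.
apply/setP => c; apply/idP/imsetP => [cB|[i _ ->]] /=; last by rewrite eb; exact: enum_valP.
by exists (enum_rank_in cB c) => //; rewrite eb /b enum_rankK_in.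
Qed.

Lemma card_span_le (y0 : Y) (e u : nat) :
  #|[set B : {set P0 * {ffun W -> Y}} | (#|B| == e) && (#|span B| <= u.+1)]| <=
  #|P0| ^ e * u.+1 ^ (e * #|W|) * #|Y| ^ u.+1.
Proof.
have -> : #|P0| ^ e * u.+1 ^ (e * #|W|) * #|Y| ^ u.+1 =
    #|{: {ffun 'I_e -> P0} * {ffun 'I_e * W -> 'I_u.+1} * {ffun 'I_u.+1 -> Y}}|.
  by rewrite !card_prod !card_ffun card_prod !card_ord.
apply: leq_trans (leq_imset_card
  (fun z : {ffun 'I_e -> P0} * {ffun 'I_e * W -> 'I_u.+1} * {ffun 'I_u.+1 -> Y} =>
   [set (z.1.1 i, [ffun j => z.2 (z.1.2 (i, j))]) | i in 'I_e]) _).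
apply/subset_leq_card/subsetP => B; rewrite inE => /andP[/eqP eB /(span_code y0)].
by rewrite -eB => -[z Bz]; apply/imsetP; exists z.
Qed.

End Span.

Section SpanWeight.
Variables (X0 Y W P0 : finType) (iota : P0 -> W -> X0) (k m : nat).

(** Configurations below the Brown-Erdős-Sós threshold [e (w - k) + k]. *)
Definition crowded : {set {set P0 * {ffun W -> Y}}} :=
  [set B : {set P0 * {ffun W -> Y}} | (1 < #|B| <= m) && (#|span iota B| < #|B| * (#|W| - k) + k)].

Lemma crowded_set0 : set0 \notin crowded.
Proof. by rewrite inE cards0. Qed.

Definition crowded_const (R : pzSemiRingType) (c : R) (p w : nat) : R :=
  (\sum_(e < m.+1) (p ^ e * (e * (w - k) + k) ^ (e * w))%:R * c ^+ e)%R.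

(** Up to a constant there are at most [|Y| ^ (e (w - k) + k - 1)] crowded families of [e] members,
    each of weight [(c / |Y| ^ (w - k)) ^ e]. What remains is one power of [|Y|] below the order
    [|Y| ^ k] of the structures built. *)
Lemma crowded_weight (R : realFieldType) (c : R) (y0 : Y) : 1 < k -> (0 <= c)%R ->
  (\sum_(B in crowded) (c / (#|Y| ^ (#|W| - k))%:R) ^+ #|B| <=
   crowded_const c #|P0| #|W| * (#|Y| ^ k.-1)%:R)%R.
Proof.
move=> k1 c0.
have Y0 : 0 < #|Y| by apply/card_gt0P; exists y0.
pose x : R := (c / (#|Y| ^ (#|W| - k))%:R)%R.
have x0 : (0 <= x)%R by rewrite divr_ge0 ?ler0n.
rewrite (partition_big (fun B : {set P0 * {ffun W -> Y}} => (inord #|B| : 'I_m.+1)) xpredT) //=.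
rewrite /crowded_const mulr_suml; apply: ler_sum => e _.
(* The successor with [k - 2] inside writes [e (w - k) + k - 1] in the form required by
   [card_span_le]. *)
apply: (@le_trans _ _ (\sum_(B in [set B : {set P0 * {ffun W -> Y}} |
   (#|B| == e) && (#|span iota B| <= (e * (#|W| - k) + k.-2).+1)%N]) x ^+ e)%R).
  rewrite [leLHS]big_mkcond [leRHS]big_mkcond; apply: ler_sum => B _.
  rewrite !inE; case: ifP => [/andP[/andP[/andP[B1 Bm] Bs] /eqP Be]|_]; last first.
    by case: ifP => // _; rewrite exprn_ge0.
  have eB : #|B| = e by rewrite -Be inordK.
  have bs : #|span iota B| <= (e * (#|W| - k) + k.-2).+1.
    by rewrite eB in Bs; move: #|span iota B| (e * _) Bs => u v; clear -k1; lia.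
  by rewrite eB eqxx bs.
rewrite sumr_const -[(_ *+ _)%R]mulr_natl.
have h := card_span_le iota y0 e (e * (#|W| - k) + k.-2).
apply: (@le_trans _ _ ((#|P0| ^ e * (e * (#|W| - k) + k.-2).+1 ^ (e * #|W|) *
    #|Y| ^ (e * (#|W| - k) + k.-2).+1)%:R * x ^+ e)%R).
  by rewrite ler_wpM2r ?exprn_ge0 // ler_nat.
have -> : (e * (#|W| - k) + k.-2).+1 = e * (#|W| - k) + k.-1.
  by move: k1; case: (k) => [|[|k']] //= _; rewrite addnS.
have -> : ((#|P0| ^ e * (e * (#|W| - k) + k.-1) ^ (e * #|W|) * #|Y| ^ (e * (#|W| - k) + k.-1))%:R * x ^+ e
   = (#|P0| ^ e * (e * (#|W| - k) + k.-1) ^ (e * #|W|))%:R * c ^+ e * (#|Y| ^ k.-1)%:R :> R)%R.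
  rewrite natrM -!mulrA; congr (_ * _)%R.
  rewrite /x expr_div_n -natrX -expnM [(#|W| - k) * e]mulnC expnD natrM.
  rewrite [LHS]mulrCA mulrA -mulrA; congr (_ * _)%R.
  by rewrite mulrAC mulfV ?mul1r // pnatr_eq0 -lt0n expn_gt0 Y0.
rewrite ler_wpM2r ?ler0n // ler_wpM2r ?exprn_ge0 // ler_nat leq_mul2l.
have [->|ew] := posnP (e * #|W|); first by rewrite !expn0 orbT.
by rewrite leq_exp2r // leq_add2l leq_pred orbT.
Qed.

End SpanWeight.

(** * Gadgets: definition and construction *)

Definition shadow (T : finType) (k : nat) (F : {set {set T}}) : {set {set T}} :=
  [set S : {set T} | (#|S| == k) && [exists A in F, S \subset A]].

Definition symdiff (T : finType) (A B : {set T}) := (A :\: B) :|: (B :\: A).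

(* The last clause says that [2(t - 1)] further sets cannot cover the symmetric difference of two
   members when those that are not members meet [A :|: B] in fewer than [k] points each. *)
Record gadget (t k : nat) (W : finType) (F : {set {set W}}) : Prop := Gadget {
  gadget_card : forall A, A \in F -> #|A| = t * k;
  gadget_inter : forall A B, A \in F -> B \in F -> A != B -> #|A :&: B| <= k;
  gadget_cover : forall (A B : {set W}) (G : {set {set W}}), A \in F -> B \in F -> A != B ->
    G \subset F -> A \notin G -> B \notin G -> #|G| <= 2 * (t - 1) ->
    (2 * (t - 1) - #|G|) * (k - 1) < #|symdiff A B :\: cover G|
}.

(** [s] counts the covering edges; [d], [i], [z] are the sizes of union, intersection and symmetric
    difference of two base edges; [s1] and [s2] are the total sizes of the covering edges inside and
    outside that union. Elimination gives [2 + zu >= 2 (r + 1) - (s + 2) k = (2 (t - 1) - s) k],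
    which suffices since [s < 2 (t - 1)]. *)
Lemma gadget_arith (t k r s zu u z i d s1 s2 sp : nat) :
  2 <= t -> 2 <= k -> k < r -> r + 1 = t * k -> s < 2 * (t - 1) ->
  s.+2 * (r - k) + k <= sp -> sp <= d + s2 -> u <= s1 -> s1 + s2 = s * r ->
  d + i = r + r -> i <= k -> z + i + i = r + r -> z <= zu + u ->
  (2 * (t - 1) - s) * (k - 1) < 2 + zu.
Proof.
move=> t2 k2 rk rd slt sp1 sp2 us ss di ik zi zu1.
have [m em] : exists m, r = m + k by exists (r - k); rewrite subnK // ltnW.
have [k' ek] : exists k', k = k'.+1 by exists k.-1; case: (k) k2.
have [t' et] : exists t', t = t'.+1 by exists t.-1; case: (t) t2.
have [u0 eu] : exists u0, 2 * t' = s + u0.+1.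
  by exists (2 * t' - s).-1; move: slt; rewrite et subSS subn0; clear; lia.
have e1 : 2 * (t - 1) - s = u0.+1 by rewrite et subSS subn0 eu addKn.
rewrite e1 ek subSS subn0.
have e2 : u0.+1 * k' + u0.+1 + s * k + 2 * k = 2 * (t * k).
  rewrite [u0.+1 * k' + _]addnC -mulnS -ek et mulSn mulnDr mulnA eu mulnDl; clear; lia.
have e3 : s.+2 * m = s * m + 2 * m by rewrite -mulnDl addn2.
have e4 : s * r = s * m + s * k by rewrite em mulnDr.
move: sp1; rewrite (_ : r - k = m); last by rewrite em addnK.
rewrite e3 => sp1; rewrite e4 in ss; rewrite -rd in e2.
move: (s * m) (s * k) (u0.+1 * k') e2 ss sp1 => A B C e2 ss sp1.
clear e1 e3 e4 eu slt t2 rd et ; lia.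
Qed.

Section GadgetOfFamily.
Variables (t k q : nat).
Hypotheses (t2 : 2 <= t) (k2 : 2 <= k).
Let r := t * k - 1.
Let E : finType := (unit * {ffun 'I_r -> 'I_q})%type.
Let X : finType := ('I_r * 'I_q)%type.
Let iota (_ : unit) (j : 'I_r) := j.
Variable F : {set E}.
Hypothesis F_sparse : forall B : {set E}, B \in crowded _ iota k (2 * t).-1 -> ~~ (B \subset F).

(** The private vertex [inr c] raises the size from [r] to [t k]; two distinct edges thus always
    differ in two points that no further edge covers. *)
Definition pedge (c : E) : {set X + E} := inr c |: inl @: cgraph iota c.

Definition pedges : {set {set X + E}} := pedge @: F.

Lemma inr_pedge c d : (inr c \in pedge d) = (c == d).
Proof.
rewrite !inE; case: (boolP (inr c \in _)) => [/imsetP[x _]//|_]; rewrite orbF.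
by apply/eqP/eqP => [[->]|->].
Qed.

Lemma inl_pedge x d : (inl x \in pedge d) = (x \in cgraph iota d).
Proof. by rewrite !inE /= mem_imset // => ? ? []. Qed.

Lemma pedge_inj : injective pedge.
Proof. by move=> c d e; apply/eqP; rewrite -inr_pedge -e inr_pedge. Qed.

Lemma r_gt : k < r.
Proof. by rewrite /r; clear -t2 k2; nia. Qed.

Lemma r_def : r + 1 = t * k.
Proof. by rewrite /r; clear -t2 k2; nia. Qed.

Lemma card_cgraph_iota (c : E) : #|cgraph iota c| = r.
Proof. by rewrite card_cgraph ?card_ord //; move=> ? ?. Qed.

Lemma pedge_card c : #|pedge c| = t * k.
Proof.
have cN : inr c \notin inl @: cgraph iota c by apply/negP => /imsetP[].
rewrite /pedge cardsU1 cN card_imset; last by move=> ? ? [].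
by rewrite card_cgraph_iota [LHS]addnC; exact: r_def.
Qed.

Lemma span_ge (B : {set E}) : B \subset F -> 1 < #|B| <= (2 * t).-1 ->
  #|B| * (r - k) + k <= #|span iota B|.
Proof.
move=> BF B2; rewrite leqNgt; apply/negP => lt.
by have := F_sparse (B := B); rewrite inE B2 card_ord lt BF => /(_ isT).
Qed.

Lemma cgraph_inter c d : c \in F -> d \in F -> c != d -> #|cgraph iota c :&: cgraph iota d| <= k.
Proof.
move=> cF dF cd.
have := @span_ge [set c; d]; rewrite subUset !sub1set cF dF cards2 cd => /(_ isT).
rewrite /span big_setU1 ?inE //= big_set1 => h.
have := cardsUI (cgraph iota c) (cgraph iota d); rewrite !card_cgraph_iota.
have t3 : 1 < 2 <= (2 * t).-1 by clear -t2; lia.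
have := h t3; have := r_gt; rewrite -[true.+1]/2.
move: #|_ :|: _| #|_ :&: _| => u i; clear; lia.
Qed.

Lemma gadget_pedges : gadget t k pedges.
Proof.
split.
- by move=> A /imsetP[c _ ->]; apply: pedge_card.
- move=> A B /imsetP[a aF ->] /imsetP[b bF ->] ab.
  have {}ab : a != b by apply: contraNneq ab => ->.
  apply: leq_trans (cgraph_inter aF bF ab).
  rewrite -(card_imset _ (@inl_inj X E)); apply: subset_leq_card; apply/subsetP => -[x|c].
    by rewrite inE !inl_pedge => h; apply: imset_f; rewrite inE.
  rewrite inE !inr_pedge => /andP[/eqP-> /eqP e]; by rewrite e eqxx in ab.
move=> A B G' /imsetP[a aF ->] /imsetP[b bF ->] ab GF aG bG cG.
have {}ab : a != b by apply: contraNneq ab => ->.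
pose G := [set c in F | pedge c \in G'].
have eG : G' = pedge @: G.
  apply/setP => A'; apply/idP/imsetP => [AG|[c]]; last by rewrite inE => /andP[_ h] ->.
  by have /imsetP[c cF e] := subsetP GF _ AG; exists c; rewrite // inE cF -e.
have eGc : #|G'| = #|G| by rewrite eG card_imset //; exact: pedge_inj.
have aG' : a \notin G by rewrite inE negb_and aG orbT.
have bG' : b \notin G by rewrite inE negb_and bG orbT.
have inrC c : c \notin G -> inr c \notin cover G'.
  move=> cN; apply/bigcupP => -[A']; rewrite eG => /imsetP[d dG ->].
  by rewrite inr_pedge => /eqP e; rewrite e dG in cN.
rewrite eGc in cG *; set s := #|G| in cG *.
set D := cgraph iota a :|: cgraph iota b.
set I := cgraph iota a :&: cgraph iota b.
pose U := \bigcup_(c in G) (cgraph iota c :&: D).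
have big1 : 2 + #|((cgraph iota a :\: cgraph iota b) :|: (cgraph iota b :\: cgraph iota a)) :\: U|
    <= #|symdiff (pedge a) (pedge b) :\: cover G'|.
  set Z := _ :|: _.
  have <- : #|[set inr a; inr b] :|: inl @: (Z :\: U)| = 2 + #|Z :\: U|.
    rewrite cardsU disjoint_setI0; last first.
      rewrite disjoints_subset; apply/subsetP => x; rewrite !inE => /orP[]/eqP->;
      by apply/negP => /imsetP[].
    rewrite cards0 subn0 card_imset; last by move=> ? ? [].
    rewrite cards2 (_ : inr a != inr b) //; by apply: contraNneq ab => -[->].
  apply/subset_leq_card/subsetP => x; rewrite inE => /orP[|].
    rewrite in_set2 => /orP[]/eqP->; rewrite in_setD inrC //= in_setU !in_setD !inr_pedge eqxx.
      by rewrite ab.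
    by rewrite eq_sym ab orbT.
  case/imsetP => v; rewrite in_setD => /andP[vU vZ] ->.
  rewrite in_setD; apply/andP; split.
    apply/bigcupP => -[A']; rewrite eG => /imsetP[c cG' ->]; rewrite inl_pedge => vc.
    case/negP: vU; apply/bigcupP; exists c => //; rewrite inE vc inE.
    by move: vZ; rewrite !inE => /orP[]/andP[_ ->]; rewrite ?orbT.
  by move: vZ; rewrite !in_setU !in_setD !inl_pedge.
apply: leq_trans big1.
(* With [2 (t - 1)] covering edges it is enough that something stays uncovered, and the private
   vertices do. Otherwise at most [2 t - 1] edges are involved, the range of [F_sparse]. *)
have [/eqP se|slt] := boolP (s == 2 * (t - 1)); first by rewrite se subnn.
have {}slt : s < 2 * (t - 1) by rewrite ltn_neqAle slt.
pose B0 := a |: (b |: G).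
have cB0 : #|B0| = s.+2.
  by rewrite !cardsU1 !inE negb_or ab (negPf aG) andbF (negPf bG) andbF.
have GF' : G \subset F by apply/subsetP => c; rewrite inE => /andP[].
have sp := @span_ge B0; rewrite !subUset !sub1set aF bF GF' cB0 in sp.
have {}sp := sp isT ltac:(by clear -slt t2; lia).
have eB0 : span iota B0 = D :|: \bigcup_(c in G) (cgraph iota c :\: D).
  have aN : a \notin b |: G by rewrite in_setU1 negb_or ab.
  rewrite /span /B0 big_setU1 //= big_setU1 //=.
  apply/setP => v; rewrite !inE -orbA; case: (boolP (v \in cgraph iota a)) => //= va.
  case: (boolP (v \in cgraph iota b)) => //= vb.
  apply/bigcupP/bigcupP => -[c cG0 vc]; exists c => //.
    by rewrite !inE (negPf va) (negPf vb).
  by move: vc; rewrite inE => /andP[].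
have le1 : #|span iota B0| <= #|D| + \sum_(c in G) #|cgraph iota c :\: D|.
  rewrite eB0; apply: leq_trans (leq_card_setU _ _) _.
  by rewrite leq_add2l card_bigcup_le.
have le2 : #|U| <= \sum_(c in G) #|cgraph iota c :&: D| by apply: card_bigcup_le.
have eq3 : \sum_(c in G) #|cgraph iota c :&: D| + \sum_(c in G) #|cgraph iota c :\: D| = s * r.
  rewrite -big_split /= -sum_nat_const; apply: eq_bigr => c _.
  by rewrite cardsID card_cgraph_iota.
have c1 := cardsUI (cgraph iota a) (cgraph iota b); rewrite !card_cgraph_iota -/D -/I in c1.
have Ik : #|I| <= k by apply: cgraph_inter.
set Z := _ :|: _.
have cZ : #|Z| + #|I| + #|I| = r + r.
  have e1 := cardsID (cgraph iota b) (cgraph iota a).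
  have e2 := cardsID (cgraph iota a) (cgraph iota b).
  rewrite !card_cgraph_iota in e1 e2; rewrite [cgraph iota b :&: _]setIC in e2.
  have : #|Z| = #|cgraph iota a :\: cgraph iota b| + #|cgraph iota b :\: cgraph iota a|.
    rewrite /Z cardsU disjoint_setI0 ?cards0 ?subn0 //.
    rewrite disjoints_subset; apply/subsetP => v; rewrite !inE => /andP[vb va].
    by rewrite va.
  rewrite -/I in e1 e2; clear -e1 e2; lia.
have cZU : #|Z| <= #|Z :\: U| + #|U|.
  by rewrite -(cardsID U Z) addnC leq_add2l subset_leq_card // subsetIr.
exact: (gadget_arith t2 k2 r_gt r_def slt sp le1 le2 eq3 c1 Ik cZ cZU).
Qed.

End GadgetOfFamily.

Lemma ffact_le_expn n k : n ^_ k <= n ^ k.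
Proof. by elim: k => // k IHk; rewrite ffactnSr expnSr leq_mul ?leq_subr. Qed.

Lemma bin_le_expn n k : 'C(n, k) <= n ^ k.
Proof.
by apply: leq_trans (ffact_le_expn n k); rewrite -bin_ffact leq_pmulr ?fact_gt0.
Qed.

(** A shadow set contains at most one private vertex. With it, [k - 1] further points of the same
    edge are chosen; without it, the set lies in the base of [(t k - 1) q] points. *)
Lemma shadow_pedges (t k q : nat) (F : {set unit * {ffun 'I_(t * k - 1) -> 'I_q}}) :
  0 < k ->
  #|shadow k (pedges F)| <=
  #|F| * 'C(t * k - 1, k - 1) + ((t * k - 1) * q) ^ k.
Proof.
move=> k0; set r := t * k - 1.
pose X : finType := ('I_r * 'I_q)%type.
pose E : finType := (unit * {ffun 'I_r -> 'I_q})%type.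
pose g (c : E) : {set X} := cgraph (fun (_ : unit) (j : 'I_r) => j) c.
pose S1 (c : E) : {set {set X + E}} :=
  [set inr c |: (@inl X E) @: T | T : {set X} in [set T : {set X} | T \subset g c & #|T| == k - 1]].
pose S2 : {set {set X + E}} :=
  [set (@inl X E) @: T | T : {set X} in [set T : {set X} | T \subset setT & #|T| == k]].
have sub : shadow k (pedges F) \subset (\bigcup_(c in F) S1 c) :|: S2.
  apply/subsetP => S; rewrite inE => /andP[/eqP cS /exists_inP[A /imsetP[c cF ->] SA]].
  pose T := [set x : X | inl x \in S].
  have inlT : (@inl X E) @: T = [set x in S | if x is inl _ then true else false].
    apply/setP => -[x|d]; rewrite inE ?andbF ?andbT; last by apply/imsetP => -[].
    by rewrite mem_imset ?inE // => ? ? [].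
  have Tc : T \subset g c.
    by apply/subsetP => x; rewrite inE => /(subsetP SA); rewrite inl_pedge.
  have noinr d : inr d \in S -> d = c by move/(subsetP SA); rewrite inr_pedge => /eqP.
  rewrite inE; have [cin|cN] := boolP (inr c \in S).
    have eS : S = inr c |: (@inl X E) @: T.
      apply/setP => -[x|d]; rewrite inlT !inE /= ?andbT ?andbF ?orbF //.
      by apply/idP/eqP => [/noinr->//|[->]].
    apply/orP; left; apply/bigcupP; exists c => //; rewrite eS; apply: imset_f.
    rewrite inE Tc /= -eqSS subn1 prednK // -cS eS cardsU1 card_imset; last by move=> ? ? [].
    by rewrite inlT inE andbF.
  have eS : S = (@inl X E) @: T.
    apply/setP => -[x|d]; rewrite inlT inE ?andbT ?andbF //.
    by apply/negP => dS; move: (dS); rewrite (noinr d dS); apply/negP.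
  apply/orP; right; rewrite eS; apply: imset_f.
  rewrite inE subsetT /= -cS eS card_imset //; by move=> ? ? [].
apply: leq_trans (subset_leq_card sub) _.
apply: leq_trans (leq_card_setU _ _) _; apply: leq_add.
  apply: leq_trans (card_bigcup_le _ _) _.
  rewrite -sum_nat_const; apply: leq_sum => c _.
  apply: leq_trans (leq_imset_card _ _) _.
  by rewrite cards_draws card_cgraph_iota.
apply: leq_trans (leq_imset_card _ _) _.
rewrite cards_draws cardsT card_prod !card_ord; exact: bin_le_expn.
Qed.

Local Open Scope ring_scope.

(** The bound [m0] on [|W|] will bring [k! C(|W|, k)] close to [|W| ^ k]. *)
Lemma gadget_exists (R : archiRealFieldType) (t k m0 : nat) (delta : R) :
  (2 <= t)%N -> (2 <= k)%N -> 0 < delta ->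
  exists (W : finType) (F : {set {set W}}), [/\ gadget t k F, F != set0,
    (m0 <= #|W|)%N &
    #|shadow k F|%:R <= #|F|%:R * ('C(t * k - 1, k - 1)%:R + delta)].
Proof.
move=> t2 k2 d0; set r := (t * k - 1)%N.
have rk : (k < r)%N by apply: r_gt.
(* Spread over [D q ^ k] edges, the at most [(r q) ^ k] base sets cost at most [delta] per edge. The
   picking probability [2 D / q ^ (r - k)] gives twice as many edges on average, and deletion may
   use up half. *)
pose D := (Num.truncn ((r ^ k)%:R / delta)).+1.
have D1 : (r ^ k)%:R <= D%:R * delta.
  rewrite -ler_pdivrMr //.
  have /andP[_ /ltW//] : (Num.truncn ((r ^ k)%:R / delta))%:R <= (r ^ k)%:R / delta < D%:R.
  by apply: truncn_itv; rewrite divr_ge0 ?ler0n // ltW.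
pose C : R := crowded_const k (2 * t).-1 (2 * D)%:R 1 r.
pose q := (maxn (Num.truncn C).+1 (maxn (2 * D) m0)).
have qC : C <= q%:R.
  apply: (@le_trans _ _ (Num.truncn C).+1%:R); last by rewrite ler_nat leq_maxl.
  have [C0|/ltW C0] := leP 0 C; last by apply: le_trans C0 (ler0n _ _).
  by have /andP[_ /ltW] := truncn_itv C0.
have qD : (2 * D <= q)%N by rewrite /q !leq_max leqnn ?orbT.
have qm : (m0 <= q)%N by rewrite /q !leq_max leqnn ?orbT.
have q0 : (0 < q)%N by apply: leq_trans qD; rewrite muln_gt0.
have y0 : 'I_q by exists 0%N.
have qR : 0 < q%:R :> R by rewrite ltr0n.
pose E : finType := (unit * {ffun 'I_r -> 'I_q})%type.
pose BB := @crowded _ 'I_q 'I_r _ (fun (_ : unit) (j : 'I_r) => j) k (2 * t).-1.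
pose p : R := (2 * D)%:R / (q ^ (r - k))%:R.
have qrk : 0 < (q ^ (r - k))%:R :> R by rewrite ltr0n expn_gt0 q0.
have p01 : 0 <= p <= 1.
  rewrite divr_ge0 ?ler0n //= ler_pdivrMr // mul1r ler_nat (leq_trans qD) //.
  by rewrite -[leqLHS]expn1 leq_pexp2l // subn_gt0.
have [F [Fs Fc]] := random_deletion p01 (crowded_set0 'I_q (fun (_ : unit) (j : 'I_r) => j) k (2 * t).-1).
have wt := crowded_weight (fun (_ : unit) (j : 'I_r) => j) (2 * t).-1 y0 k2 (ler0n R (2 * D)).
rewrite card_unit !card_ord -/BB -/p in wt.
have cF : D%:R * (q ^ k)%:R <= #|F|%:R :> R.
  apply: le_trans Fc.
  have -> : #|{: E}| = (q ^ r)%N by rewrite /E card_prod card_unit card_ffun !card_ord mul1n.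
  have -> : p * (q ^ r)%:R = 2 * D%:R * (q ^ k)%:R.
    have -> : (q ^ r)%:R = (q ^ (r - k))%:R * (q ^ k)%:R :> R.
      by rewrite -natrM -expnD subnK // ltnW.
    by rewrite /p mulrA divfK ?gt_eqF // natrM.
  have : \sum_(B in BB) p ^+ #|B| <= D%:R * (q ^ k)%:R.
    apply: le_trans wt _.
    apply: (@le_trans _ _ (q%:R * (q ^ k.-1)%:R)); first by rewrite ler_wpM2r ?ler0n.
    by rewrite -natrM -expnS prednK ?(ltnW k2) // ler_peMl ?ler0n // ler1n.
  rewrite -mulrA; move: (\sum_(B in BB) _) (D%:R * (q ^ k)%:R) => x y; lra.
have F0 : (0 < #|F|)%N.
  rewrite -(ltr0n R); apply: lt_le_trans cF; by rewrite -natrM ltr0n muln_gt0 expn_gt0 q0.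
have cP : #|pedges F| = #|F| by rewrite card_imset //; exact: pedge_inj.
exists ('I_r * 'I_q + E)%type, (pedges F); split.
- exact: gadget_pedges.
- by rewrite -card_gt0 cP.
- rewrite card_sum card_prod !card_ord (leq_trans qm) // (leq_trans _ (leq_addr _ _)) //.
  by rewrite leq_pmull // (leq_trans _ rk).
rewrite cP; apply: (@le_trans _ _ (#|F| * 'C(t * k - 1, k - 1) + ((t * k - 1) * q) ^ k)%:R).
  by rewrite ler_nat shadow_pedges // ltnW.
rewrite natrD natrM mulrDr lerD2l -/r expnMn natrM.
apply: (@le_trans _ _ (D%:R * delta * (q ^ k)%:R)); first by rewrite ler_wpM2r ?ler0n.
by rewrite mulrAC ler_wpM2r // ltW.
Qed.

Local Close Scope ring_scope.

(** * Cancellative unions of copies *)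

Section CopiesCancellative.
Variables (t k : nat) (W X C : finType) (F : {set {set W}}).
Variables (emb : C -> W -> X) (M : {set C}).
Hypotheses (t2 : 2 <= t) (k2 : 2 <= k) (gF : gadget t k F).
Hypothesis emb_inj : forall c, injective (emb c).

Let img c : {set X} := emb c @: W.

Hypothesis copies_meet : forall c d A, c \in M -> d \in M -> c != d -> A \in F ->
  #|emb d @: A :&: img c| < k.
Hypothesis copies_sparse : forall B : {set C}, B \subset M -> 1 < #|B| <= 2 * t ->
  #|B| * (#|W| - k) + k <= #|\bigcup_(c in B) img c|.

Definition copies : {set {set X}} :=
  [set emb x.1 @: (x.2 : {set W}) | x in setX M F].

Lemma copiesP E : reflect (exists c A, [/\ c \in M, A \in F & E = emb c @: (A : {set W})]) (E \in copies).
Proof.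
apply: (iffP imsetP) => [[[c A]]|[c [A [cM AF ->]]]].
  by rewrite inE /= => /andP[cM AF] ->; exists c, A.
by exists (c, A); rewrite ?inE /= ?cM.
Qed.

Lemma sub_img c (A : {set W}) : emb c @: A \subset img c.
Proof. by apply/subsetP => _ /imsetP[w _ ->]; apply: imset_f. Qed.

Lemma card_emb c (A : {set W}) : #|emb c @: A| = #|A|.
Proof. by rewrite card_imset //; apply: emb_inj. Qed.

Lemma le_k_tk : k <= t * k.
Proof. by rewrite leq_pmull // ltnW. Qed.

Lemma same_copy c d (A B : {set W}) : c \in M -> d \in M -> A \in F -> B \in F ->
  emb c @: A = emb d @: B -> c = d.
Proof.
move=> cM dM AF BF e; apply/eqP/negPn/negP => cd.
have := copies_meet cM dM cd BF; rewrite -e (setIidPl (sub_img c A)) card_emb.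
by rewrite (gadget_card gF AF) ltnNge le_k_tk.
Qed.

Lemma card_copies : #|copies| = #|M| * #|F|.
Proof.
rewrite card_in_imset ?cardsX // => -[c A] [d B]; rewrite !inE /= => /andP[cM AF] /andP[dM BF] e.
have ecd := same_copy cM dM AF BF e.
by move: e; rewrite ecd => /(imset_inj (@emb_inj d)) ->.
Qed.

Lemma rgraph_copies : rgraph (t * k) copies.
Proof.
apply/forall_inP => E /copiesP[c [A [_ AF ->]]].
by rewrite card_emb (gadget_card gF AF).
Qed.

(** The members of [AA] in the copy [c] pull back to [G]; the at most [2 (t - 1) - |G|] others meet
    that copy in at most [k - 1] points each, too few for what [gadget_cover] leaves uncovered. *)
Lemma cover_in_copy (c : C) (B D : {set W}) (AA : {set {set X}}) :
  c \in M -> B \in F -> D \in F -> B != D -> AA \subset copies ->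
  emb c @: B \notin AA -> emb c @: D \notin AA -> #|AA| <= 2 * (t - 1) ->
  ~~ (symdiff (emb c @: B) (emb c @: D) \subset cover AA).
Proof.
move=> cM BF DF BD AAc BN DN cA; apply/negP => sub.
pose G := [set A in F | emb c @: (A : {set W}) \in AA].
pose inA := [set emb c @: (A : {set W}) | A in G].
have cin : #|inA| = #|G| by rewrite card_imset //; apply: imset_inj; apply: emb_inj.
have inAA : inA \subset AA by apply/subsetP => _ /imsetP[A + ->]; rewrite inE => /andP[].
have GF : G \subset F by apply/subsetP => A; rewrite inE => /andP[].
have cG : #|G| <= 2 * (t - 1) by rewrite -cin (leq_trans (subset_leq_card inAA)).
have := gadget_cover gF BF DF BD GF _ _ cG.
rewrite !inE (negPf BN) (negPf DN) !andbF => /(_ isT isT); rewrite ltnNge => /negP; apply.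
set S := symdiff B D :\: cover G.
have sub2 : emb c @: S \subset \bigcup_(A in AA :\: inA) (A :&: img c).
  apply/subsetP => x /imsetP[w]; rewrite inE => /andP[wG wBD] ->.
  have : emb c w \in cover AA.
    apply: (subsetP sub); move: wBD; rewrite !in_setU !in_setD !mem_imset //; exact: emb_inj.
  case/bigcupP => A AA' wA; apply/bigcupP; exists A; last first.
    by rewrite inE wA; apply: imset_f.
  rewrite inE AA' andbT; apply: contra wG => /imsetP[A0 A0G eA].
  by apply/bigcupP; exists A0 => //; move: wA; rewrite eA mem_imset //; apply: emb_inj.
rewrite -(card_emb c) (leq_trans (subset_leq_card sub2)) //.
apply: leq_trans (card_bigcup_le _ _) _.
apply: (@leq_trans (\sum_(A in AA :\: inA) (k - 1))).
  apply: leq_sum => A; rewrite inE => /andP[AN AAA].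
  have /copiesP[d [A0 [dM A0F eA]]] := subsetP AAc _ AAA.
  have cd : c != d.
    apply: contraNneq AN => ecd; apply/imsetP; exists A0; last by rewrite ecd.
    by rewrite inE A0F ecd -eA.
  by have := copies_meet cM dM cd A0F; rewrite -eA; move: #|_| => x; clear -k2; lia.
rewrite sum_nat_const leq_mul2r; apply/orP; right.
have := cardsID inA AA; rewrite (setIidPr inAA) cin => e.
by move: cA; rewrite -e; move: #|_| #|_| (2 * _) => x y z; clear; lia.
Qed.

(** Let [z] be the overlap of the two copies. By sparsity, [o] further copies meet their union in at
    most [(o + 1) k - z] points. A covering edge in the same copy takes at most [k] points of its
    edge, and the part of each edge inside the opposite copy is counted separately. Summing over
    both edges, with [a] covering edges inside the two copies, gives [2 t k <= (k - 1) + z + a k +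
    (o + 1) k - z], which is at most [2 t k - 1] because [a + o <= 2 (t - 1)]. *)
Lemma cover_two_copies (b c : C) (B D : {set W}) (AA : {set {set X}}) :
  b \in M -> c \in M -> b != c -> B \in F -> D \in F -> AA \subset copies ->
  emb b @: B \notin AA -> emb c @: D \notin AA -> #|AA| <= 2 * (t - 1) ->
  ~~ (symdiff (emb b @: B) (emb c @: D) \subset cover AA).
Proof.
move=> bM cM bc BF DF AAc BN DN cA; apply/negP => sub.
pose inn d := [set A in AA | A \in [set emb d @: (A0 : {set W}) | A0 in F]].
pose O := AA :\: (inn b :|: inn c).
have inn_sub d A : A \in inn d -> A \subset img d.
  by rewrite inE => /andP[_ /imsetP[A0 _ ->]]; apply: sub_img.
have dis_inn : [disjoint inn b & inn c].
  rewrite disjoints_subset; apply/subsetP => A; rewrite !inE => /andP[AAA /imsetP[A0 A0F eA]].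
  apply/negP => /andP[_ /imsetP[A1 A1F eA']]; case/eqP: bc.
  by apply: same_copy bM cM A0F A1F _; rewrite -eA.
have cAA : #|inn b| + #|inn c| + #|O| <= 2 * (t - 1).
  rewrite (leq_trans _ cA) // -(cardsID (inn b :|: inn c) AA) leq_add2r.
  have /setIidPr -> : inn b :|: inn c \subset AA.
    by rewrite subUset; apply/andP; split; apply/subsetP => A; rewrite inE => /andP[].
  by rewrite cardsU disjoint_setI0 // cards0 subn0.
pose f (A : {set X}) := odflt b [pick d in M | A \in [set emb d @: (A0 : {set W}) | A0 in F]].
have fP A : A \in O -> [/\ f A \in M, A \subset img (f A), f A != b & f A != c].
  rewrite in_setD in_setU negb_or => /andP[/andP[Ab Ac] AAA].
  rewrite /f; case: pickP => [d /andP[dM dA]|none]; last first.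
    have /copiesP[d [A0 [dM A0F eA]]] := subsetP AAc _ AAA.
    by have := none d; rewrite dM eA imset_f.
  split=> //=; first by case/imsetP: dA => A0 _ ->; apply: sub_img.
    by apply: contraNneq Ab => <-; rewrite inE AAA.
  by apply: contraNneq Ac => <-; rewrite inE AAA.
pose Ks := f @: O.
have cK : #|Ks| <= #|O| by apply: leq_imset_card.
have KsP d : d \in Ks -> [/\ d \in M, d != b & d != c].
  by case/imsetP => A AO ->; have [] := fP A AO.
pose B0 := b |: (c |: Ks).
have cN : c \notin Ks by apply/negP => /KsP[]; rewrite eqxx.
have bN : b \notin c |: Ks.
  by rewrite in_setU1 negb_or bc; apply/negP => /KsP[_]; rewrite eqxx.
have cB0 : #|B0| = #|Ks|.+2 by rewrite cardsU1 bN cardsU1 cN.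
have B0M : B0 \subset M.
  rewrite !subUset !sub1set bM cM; apply/subsetP => d /KsP[]//.
set Db := img b :|: img c.
have le1 : #|\bigcup_(d in B0) img d| <= #|Db| + \sum_(d in Ks) #|img d :\: Db|.
  rewrite /B0 big_setU1 //= big_setU1 //= setUA -/Db.
  have -> : Db :|: \bigcup_(d in Ks) img d = Db :|: \bigcup_(d in Ks) (img d :\: Db).
    apply/setP => x; rewrite !(in_setU x Db); case: (boolP (x \in Db)) => //= xD.
    apply/bigcupP/bigcupP => -[d dK xd]; exists d => //; first by rewrite inE xD.
    by move: xd; rewrite inE => /andP[].
  apply: leq_trans (leq_card_setU _ _) _; by rewrite leq_add2l card_bigcup_le.
have cimg d : #|img d| = #|W| by rewrite card_imset // ; apply: emb_inj.
have eq2 : \sum_(d in Ks) #|img d :&: Db| + \sum_(d in Ks) #|img d :\: Db| = #|Ks| * #|W|.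
  by rewrite -big_split /= -sum_nat_const; apply: eq_bigr => d _; rewrite cardsID cimg.
set z := #|img b :&: img c|.
have eq3 : #|Db| + z = #|W| + #|W| by rewrite cardsUI !cimg.
have sp := @copies_sparse B0 B0M; rewrite cB0 in sp.
pose UO := \bigcup_(d in Ks) (img d :&: Db).
have cUO : #|UO| <= \sum_(d in Ks) #|img d :&: Db| by apply: card_bigcup_le.
(* A point of the edge outside the opposite copy lies in a further copy, hence in [UO], or in an
   edge of its own copy sharing at most [k] points with it. *)
have half d d' (A0 : {set W}) : d \in M -> A0 \in F -> emb d @: A0 \notin AA ->
    (emb d @: A0) :\: img d' \subset cover AA -> img d \subset Db ->
    (forall A, A \in AA -> A \notin O -> ~~ (A \subset img d') -> A \in inn d) ->
    t * k <= #|emb d @: A0 :&: img d'| + #|inn d| * k + #|(emb d @: A0 :\: img d') :&: UO|.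
  move=> dM A0F A0N subd dD inO.
  rewrite -{1}(gadget_card gF A0F) -(card_emb d) -(cardsID (img d') (emb d @: A0)) -addnA leq_add2l.
  rewrite -(cardsID UO (_ :\: img d')) addnC leq_add2r.
  have sub3 : (emb d @: A0 :\: img d') :\: UO \subset \bigcup_(A in inn d) (A :&: emb d @: A0).
    apply/subsetP => x; rewrite in_setD => /andP[xU xd].
    have /bigcupP[A AAA xA] := subsetP subd x xd.
    move: (xd); rewrite in_setD => /andP[xd' xA0].
    have [AO|AO] := boolP (A \in O).
      have [fM Af _ _] := fP A AO; case/negP: xU; apply/bigcupP; exists (f A); first exact: imset_f.
      by rewrite inE (subsetP Af) // (subsetP dD) // (subsetP (sub_img d A0)).
    apply/bigcupP; exists A; last by rewrite inE xA.
    apply: inO => //; apply: contra xd' => /subsetP; exact.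
  apply: leq_trans (subset_leq_card sub3) _; apply: leq_trans (card_bigcup_le _ _) _.
  rewrite -sum_nat_const; apply: leq_sum => A; rewrite inE => /andP[AAA /imsetP[A1 A1F eA]].
  have A10 : A1 != A0 by apply: contraNneq A0N => <-; rewrite -eA.
  rewrite eA -imsetI; last by move=> ? ? _ _; apply: emb_inj.
  by rewrite card_emb (gadget_inter gF).
have hb : t * k <= #|emb b @: B :&: img c| + #|inn b| * k + #|(emb b @: B :\: img c) :&: UO|.
  apply: half => //.
  - apply: subset_trans sub; apply/subsetP => x; rewrite in_setD => /andP[xc xB].
    rewrite in_setU in_setD xB andbT (contra _ xc) //; exact/subsetP/sub_img.
  - exact: subsetUl.
  - move=> A AAA; rewrite in_setD AAA andbT negbK in_setU => /orP[//|/inn_sub ->//].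
have hc : t * k <= #|emb c @: D :&: img b| + #|inn c| * k + #|(emb c @: D :\: img b) :&: UO|.
  apply: half => //.
  - apply: subset_trans sub; apply/subsetP => x; rewrite in_setD => /andP[xc xB].
    rewrite in_setU [X in _ || X]in_setD xB andbT (contra _ xc) ?orbT //; exact/subsetP/sub_img.
  - exact: subsetUr.
  - move=> A AAA; rewrite in_setD AAA andbT negbK in_setU => /orP[/inn_sub ->//|//].
have hbc : #|(emb b @: B :\: img c) :&: UO| + #|(emb c @: D :\: img b) :&: UO| <= #|UO|.
  set S1 := _ :&: UO; set S2 := _ :&: UO.
  have d12 : [disjoint S1 & S2].
    rewrite disjoints_subset; apply/subsetP => x; rewrite inE in_setD => /andP[/andP[xc xb] _].
    rewrite inE /S2 inE in_setD (subsetP (sub_img b B)) //.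
  have <- : #|S1 :|: S2| = #|S1| + #|S2| by rewrite cardsU disjoint_setI0 // cards0 subn0.
  by rewrite subset_leq_card // subUset !subsetIr.
(* One intersection is bounded by [k - 1], the other by the overlap [z], which cancels against the
   sparsity bound. *)
have m1 : #|emb b @: B :&: img c| < k by apply: copies_meet => //; rewrite eq_sym.
have m2 : #|emb c @: D :&: img b| <= z.
  by rewrite /z setIC subset_leq_card // setIS // sub_img.
have kW : k <= #|W|.
  by apply: leq_trans le_k_tk _; rewrite -(gadget_card gF BF) max_card.
have {}sp := sp ltac:(by clear -cAA cK t2; lia).
move: sp eq2 eq3 le1 cUO hb hc hbc m1 m2 cAA cK kW t2.
move: #|\bigcup_(d in B0) img d| #|Db| (\sum_(d in Ks) _) (\sum_(d in Ks) _) #|UO|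
  #|emb b @: B :&: img c| #|emb c @: D :&: img b| #|(_ :\: _) :&: UO| #|(_ :\: _) :&: UO|
  #|inn b| #|inn c| #|O| #|Ks| #|W| z => u d s1 s2 v p q h1 h2 a b' o kk w z.
clear; move=> sp eq2 eq3 le1 cUO hb hc hbc m1 m2 cAA cK kW t2.
have [m em] : exists m, w = m + k by exists (w - k); rewrite subnK.
have [t' et] : exists t', t = t'.+1 by exists t.-1; case: (t) t2.
have e3 : kk.+2 * m = kk * m + 2 * m by rewrite -mulnDl addn2.
have e4 : kk * w = kk * m + kk * k by rewrite em mulnDr.
have e5 : a * k + b' * k + kk * k <= 2 * (t' * k).
  by rewrite -!mulnDl mulnA leq_mul2r; apply/orP; right; move: cAA; rewrite et subSS subn0; clear -cK; lia.
move: sp; rewrite (_ : w - k = m); last by rewrite em addnK.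
rewrite e3 => sp; rewrite e4 in eq2.
rewrite et mulSn in hb hc.
move: (kk * m) (kk * k) (a * k) (b' * k) (t' * k) e5 sp eq2 hb hc => A1 A2 A3 A4 A5 e5 sp eq2 hb hc.
clear e3 e4 et t2 cAA cK; lia.
Qed.

Lemma cancellative_copies : cancellative (2 * (t - 1)) copies.
Proof.
apply/forallP => A; apply/forallP => B; apply/forallP => D; apply/implyP.
case/and4P => /allP AH BH DH /= /and3P[BN DN uA].
pose AA := [set E in (A : seq {set X})].
have cAA : #|AA| <= 2 * (t - 1) by rewrite cardsE (leq_trans (card_size _)) ?size_tuple.
have AAc : AA \subset copies by apply/subsetP => E; rewrite inE => /AH.
have eU : \bigcup_(i < 2 * (t - 1)) tnth A i = cover AA.
  rewrite /cover; apply/setP => x; apply/bigcupP/bigcupP => [[i _ xi]|[E]].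
    by exists (tnth A i) => //; rewrite inE mem_tnth.
  by rewrite inE => /tnthP[i ->] xi; exists i.
move: BN; rewrite in_cons negb_or => /andP[BD BN].
apply/eqP => e.
have sub : symdiff B D \subset cover AA.
  rewrite -eU; apply/subsetP => x; rewrite in_setU !in_setD => /orP[]/andP[xN xY].
    have : x \in \bigcup_(i < 2 * (t - 1)) tnth A i :|: D by rewrite -e in_setU xY orbT.
    by rewrite in_setU (negPf xN) orbF.
  have : x \in \bigcup_(i < 2 * (t - 1)) tnth A i :|: B by rewrite e in_setU xY orbT.
  by rewrite in_setU (negPf xN) orbF.
have BNA : B \notin AA by rewrite inE.
have DNA : D \notin AA by rewrite inE.
case/copiesP: BH => b [B0 [bM B0F eB]]; case/copiesP: DH => c [D0 [cM D0F eD]].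
subst B D; have [ebc|bc] := eqVneq b c; last first.
  by have := cover_two_copies bM cM bc B0F D0F AAc BNA DNA cAA; rewrite sub.
subst c; have B0D0 : B0 != D0 by apply: contraNneq BD => ->.
by have := cover_in_copy bM B0F D0F B0D0 AAc BNA DNA cAA; rewrite sub.
Qed.

End CopiesCancellative.

(** * Edge-transitive hosts *)

Lemma perm_imset_eq (T : finType) (A B : {set T}) : #|A| = #|B| ->
  exists s : {perm T}, s @: A = B.
Proof.
move=> cAB.
pose a := enum A ++ enum (~: A); pose b := enum B ++ enum (~: B).
have ua (C : {set T}) : uniq (enum C ++ enum (~: C)).
  rewrite cat_uniq !enum_uniq /= andbT; apply/hasPn => x; rewrite !mem_enum.
  by rewrite inE.
have ma (C : {set T}) x : x \in enum C ++ enum (~: C) by rewrite mem_cat !mem_enum inE orbN.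
have sz (C : {set T}) : size (enum C ++ enum (~: C)) = #|T| by rewrite size_cat -!cardE cardsC.
pose f x := nth x b (index x a).
have ia x : index x a < #|T| by rewrite -(sz A) index_mem ma.
have f_inj : injective f.
  move=> x y; rewrite /f (set_nth_default y) ?sz // => /eqP.
  rewrite nth_uniq ?sz ?ua // => /eqP e.
  by rewrite -(nth_index x (ma A x)) -/a e /a nth_index.
exists (perm f_inj); apply/eqP; rewrite eqEcard.
rewrite card_imset ?cAB ?leqnn ?andbT; last exact: perm_inj.
apply/subsetP => _ /imsetP[x xA ->]; rewrite permE /f /b nth_cat.
have -> : index x a < size (enum B).
  by rewrite /a index_cat mem_enum xA -cardE -cAB cardE index_mem mem_enum.
by rewrite -[_ \in B]mem_enum mem_nth // /a index_cat mem_enum xA -cardE -cAB cardE index_mem mem_enum.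
Qed.

Lemma card_ffun_fixed (W Y : finType) (I : {set W}) (g : W -> Y) :
  #|[set y : {ffun W -> Y} | [forall i in I, y i == g i]]| = #|Y| ^ (#|W| - #|I|).
Proof.
pose F (x : W) : pred Y := if x \in I then pred1 (g x) else predT.
rewrite (_ : #|_| = #|family F|); last first.
  apply: eq_card => y; rewrite !inE; apply/forall_inP/familyP => [h x|h x xI].
    by rewrite /F; case: ifP => // xI; rewrite inE h.
  by have := h x; rewrite /F xI inE.
rewrite card_family foldrE big_map big_enum /=.
rewrite (bigID (mem I)) /= big1 => [|x xI]; last by rewrite /F xI card1.
rewrite mul1n (eq_bigr (fun=> #|Y|)) => [|x /negPf xN]; last by rewrite /F xN.
rewrite prod_nat_const -(cardsC I) addKn; congr (_ ^ _).
by apply: eq_card => x; rewrite !inE.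
Qed.

Lemma perm_preserves_iff (T : finType) (L : {set {set T}}) (s : {perm T}) :
  (forall A : {set T}, A \in L -> s @: A \in L) -> forall A : {set T}, (s @: A \in L) = (A \in L).
Proof.
move=> h A; apply/idP/idP => [sA|/h//].
have e : [set s @: B | B : {set T} in L] = L.
  apply/eqP; rewrite eqEcard card_imset ?leqnn ?andbT; last by apply: imset_inj; apply: perm_inj.
  by apply/subsetP => _ /imsetP[B BL ->]; apply: h.
rewrite -e in sA; case/imsetP: sA => B BL /imset_inj eAB.
by rewrite (eAB _) //; apply: perm_inj.
Qed.

Local Open Scope ring_scope.

Section ColouredGraph.
Variables (W : finType) (F : finFieldType) (k : nat).
Hypothesis k_gt0 : (0 < k)%N.

Local Notation V := {ffun {set W} -> F}.
Implicit Types (I J : {set W}) (u v : {ffun W -> V}).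

(** Index set [I] reads coordinate [I] only. Vectors indexed by all subsets of [W] thus let colours
    over different index sets be prescribed independently. *)
Definition colour I u : F := \sum_(i in I) u i I.

Definition pgraph I u : {set W * V} := [set (i, u i) | i in I].

Definition coloured : {set {set W * V}} :=
  [set pgraph x.1 x.2 | x in [set x : {set W} * {ffun W -> V} | (#|x.1| == k) && (colour x.1 x.2 != 0)]].

Lemma card_pgraph I u : #|pgraph I u| = #|I|.
Proof. by rewrite card_imset // => i j []. Qed.

Lemma pgraph_inj I J u v : pgraph I u = pgraph J v -> I = J /\ {in I, u =1 v}.
Proof.
have sub I' J' u' v' : pgraph I' u' = pgraph J' v' -> I' \subset J'.
  move=> e; apply/subsetP => i iI.
  have : (i, u' i) \in pgraph J' v' by rewrite -e; apply: imset_f.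
  by case/imsetP => j jJ [->].
move=> e; split; first by apply/eqP; rewrite eqEsubset (sub _ _ _ _ e) (sub _ _ _ _ (esym e)).
move=> i iI; have : (i, u i) \in pgraph J v by rewrite -e; apply: imset_f.
by case/imsetP => j jJ [->].
Qed.

Lemma coloured_pgraph I u : #|I| = k -> (pgraph I u \in coloured) = (colour I u != 0).
Proof.
move=> cI; apply/imsetP/idP => [[[J v]]|cn0]; last by exists (I, u); rewrite ?inE /= ?cI ?eqxx.
rewrite inE /= => /andP[_ vn0] /pgraph_inj[eIJ euv].
rewrite -eIJ in vn0; apply: contraNneq vn0 => u0; rewrite -u0; apply/eqP.
by apply: eq_bigr => i iI; rewrite euv.
Qed.

Lemma card_coloured S : S \in coloured -> #|S| = k.
Proof. by case/imsetP => -[I u]; rewrite inE => /andP[/eqP cI _] ->; rewrite card_pgraph. Qed.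

(** In each [J] one chosen element carries the whole colour, 1 or 0 according to membership of [J]
    in [G]. The copy is induced because [k]-sets outside [G] get colour 0. *)
Lemma coloured_embedding (G : {set {set W}}) :
  exists u : {ffun W -> V}, forall I, #|I| = k -> (pgraph I u \in coloured) = (I \in G).
Proof.
exists [ffun j => [ffun J : {set W} => if [pick x in J] == Some j then (J \in G)%:R else 0]].
move=> I cI; rewrite coloured_pgraph // /colour.
have [I0|[x xI]] := set_0Vmem I; first by move: k_gt0; rewrite -cI I0 cards0.
have [y yI ey] : exists2 y, y \in I & [pick x in I] = Some y.
  by case: pickP => [y yI|/(_ x)]; [exists y | rewrite xI].
rewrite (bigD1 y) //= !ffunE ey eqxx big1 ?addr0 => [|i /andP[_ iy]].
  by case: (I \in G); rewrite ?oner_eq0 // eqxx.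
by rewrite !ffunE ey; case: eqP => // -[e]; rewrite e eqxx in iy.
Qed.

(* The automorphism permutes [W], scales all colours by [l], and translates by a [tau] whose colours
   vanish. *)
Lemma coloured_transitive S S' : S \in coloured -> S' \in coloured ->
  exists s : {perm W * V}, (forall A : {set W * V}, (s @: A \in coloured) = (A \in coloured)) /\ s @: S = S'.
Proof.
case/imsetP => -[I v]; rewrite inE /= => /andP[/eqP cI vn0] ->.
case/imsetP => -[I' v']; rewrite inE /= => /andP[/eqP cI' vn0'] ->.
have [pi epi] : exists s : {perm W}, s @: I = I' by apply: perm_imset_eq; rewrite cI.
pose l := colour I' v' / colour I v.
have ln0 : l != 0 by rewrite mulf_neq0 ?invr_eq0.
pose d j J := v' j J - l * v (pi^-1%g j) ((pi^-1)%g @: J).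
(* On [I'] the translation is dictated by the target [v'], and its sum over [I'] at coordinate [I']
   vanishes by the choice of [l]. Any other [k]-set [J] has a chosen element outside [I'], which
   absorbs the sum. *)
pose tau j J := if j \in I' then d j J
  else if [pick x in J :\: I'] == Some j then - \sum_(i in J :&: I') d i J else 0.
have piK J : (pi^-1)%g @: (pi @: J) = J.
  by rewrite -imset_comp (eq_imset (g := id)) ?imset_id // => x /=; rewrite permK.
have tau0 J : #|J| = k -> \sum_(j in J) tau j J = 0.
  move=> cJ; rewrite (bigID (mem I')) /=.
  rewrite (eq_bigr (fun j => d j J)) => [|j /andP[_ jI]]; last by rewrite /tau jI.
  have [eJ|neJ] := eqVneq J I'.
    rewrite [X in _ + X]big1 => [|j /andP[jJ]]; last by rewrite -eJ jJ.
    rewrite addr0 eJ (eq_bigl (mem I')) => [|j]; last by rewrite andbb.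
    rewrite sumrB -mulr_sumr -{1}epi.
    rewrite [X in _ - _ * X](_ : _ = colour I v).
      by rewrite divfK // epi subrr.
    rewrite /colour -{1}epi big_imset /=; last by move=> ? ? _ _; apply: perm_inj.
    by apply: eq_bigr => i _; rewrite permK -epi piK.
  have [JD0|[x xJD]] := set_0Vmem (J :\: I').
    case/eqP: neJ; apply/eqP; rewrite eqEcard cJ cI' leqnn andbT.
    by rewrite -setD_eq0 JD0.
  have [y yJD ey] : exists2 y, y \in J :\: I' & [pick x in J :\: I'] = Some y.
    by case: pickP => [y yI|/(_ x)]; [exists y | rewrite xJD].
  have yJD' := yJD; rewrite inE in yJD'; case/andP: yJD' => yN yJ.
  rewrite [X in _ + X](bigD1 y) ?yJ ?yN //= [X in _ + (_ + X)]big1; last first.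
    move=> j /andP[/andP[jJ jN] jy]; rewrite /tau (negPf jN) ey.
    by case: eqP => // -[e]; rewrite e eqxx in jy.
  rewrite /tau (negPf yN) ey eqxx addr0 [X in _ - X](eq_bigl (fun j => (j \in J) && (j \in I'))) ?subrr //.
  by move=> j; rewrite inE.
pose s0 (x : W * V) : W * V := (pi x.1, [ffun J : {set W} => l * x.2 ((pi^-1)%g @: J) + tau (pi x.1) J]).
have s0_inj : injective s0.
  move=> [i u] [j w] [/perm_inj -> e]; congr pair; apply/ffunP => J.
  have := congr1 (fun f : V => f (pi @: J)) e.
  by rewrite /= !ffunE piK => /addIr /(mulfI ln0).
pose s := perm s0_inj.
pose act (u : {ffun W -> V}) : {ffun W -> V} :=
  [ffun j => [ffun K : {set W} => l * u ((pi^-1)%g j) ((pi^-1)%g @: K) + tau j K]].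
have sE J u : s @: pgraph J u = pgraph (pi @: J) (act u).
  rewrite /pgraph -!imset_comp; apply: eq_imset => j /=.
  rewrite permE /s0 /=; congr pair; rewrite /act ffunE permK.
  by apply/ffunP => K; rewrite !ffunE.
exists s; split.
  apply: perm_preserves_iff => A /imsetP[[J u]]; rewrite inE /= => /andP[/eqP cJ un0] ->.
  have cpJ : #|pi @: J| = k by rewrite card_imset //; apply: perm_inj.
  rewrite sE coloured_pgraph // /colour.
  under eq_bigr do rewrite !ffunE.
  rewrite big_split /= tau0 // addr0 -mulr_sumr mulf_neq0 //.
  rewrite big_imset /=; last by move=> ? ? _ _; apply: perm_inj.
  by under eq_bigr do rewrite permK piK.
rewrite sE epi; apply: eq_in_imset => j jI; congr pair.
apply/ffunP => K; rewrite !ffunE /tau jI /d; ring.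
Qed.

(** Adding a constant at one coordinate ([sh]) shows that all colours over a [k]-set are equally
    frequent, so a proportion [1 - 1 / |F|] is nonzero. Each edge arises from at most
    [|V| ^ (|W| - k)] functions. *)
Lemma card_coloured_ge (R : realFieldType) :
  'C(#|W|, k)%:R * (#|V| ^ k)%:R * (1 - #|F|%:R^-1) <= #|coloured|%:R :> R.
Proof.
have V0 : (0 < #|V|)%N by apply/card_gt0P; exists 0.
have F0 : (0 < #|F|)%N by apply/card_gt0P; exists 0.
have [lt|kW] := ltnP #|W| k.
  by rewrite bin_small // !mul0r ler0n.
have zero I : #|I| = k -> (#|[set u : {ffun W -> V} | colour I u == 0%R]| * #|F| = #|V| ^ #|W|)%N.
  move=> cI; have [i iI] : exists i, i \in I by apply/card_gt0P; rewrite cI.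
  pose sh (c : F) (u : {ffun W -> V}) : {ffun W -> V} :=
    [ffun j => [ffun J => u j J + if (j == i) && (J == I) then c else 0]].
  have csh c u : colour I (sh c u) = colour I u + c.
    rewrite /colour; under eq_bigr do rewrite !ffunE eqxx andbT.
    rewrite big_split /=; congr (_ + _).
    rewrite (bigD1 i) //= eqxx big1 ?addr0 // => j /andP[_ /negPf->//].
  have shK c u : sh (- c) (sh c u) = u.
    apply/ffunP => j; apply/ffunP => J; rewrite !ffunE.
    by case: ifP => _; rewrite ?addr0 ?addrK.
  have fib (c : F) : #|[set u : {ffun W -> V} | colour I u == c]| = #|[set u : {ffun W -> V} | colour I u == 0]|.
    rewrite -[RHS](card_imset _ (can_inj (shK c))); congr #|pred_of_set _|.
    apply/setP => u; rewrite inE; apply/eqP/imsetP => [uc|[w]]; last first.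
      by rewrite inE => /eqP w0 ->; rewrite csh w0 add0r.
    exists (sh (- c) u); first by rewrite inE csh uc subrr.
    by rewrite -{1}[c]opprK shK.
  apply: esym; rewrite -card_ffun -[LHS]sum1_card (partition_big (colour I) xpredT) //= mulnC -sum_nat_const.
  by apply: eq_big => [c|c _]; rewrite ?inE // sum1dep_card -(fib c).
have nonzero I : #|I| = k -> #|[set u : {ffun W -> V} | colour I u != 0]|%:R =
    (#|V| ^ #|W|)%:R * (1 - #|F|%:R^-1) :> R.
  move=> cI; have FR : #|F|%:R != 0 :> R by rewrite pnatr_eq0 -lt0n.
  have := zero I cI; set Z := [set u | _] => eZ.
  have := cardsC Z; rewrite card_ffun => eC.
  have -> : [set u : {ffun W -> V} | colour I u != 0] = ~: Z by apply/setP => u; rewrite !inE.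
  have -> : #|~: Z|%:R = (#|V| ^ #|W|)%:R - #|Z|%:R :> R by rewrite -eC natrD addrC addKr.
  by rewrite mulrBr mulr1; congr (_ - _); rewrite -eZ natrM mulfK.
pose Q := [set x : {set W} * {ffun W -> V} | (#|x.1| == k) && (colour x.1 x.2 != 0)].
have cQ : #|Q|%:R = 'C(#|W|, k)%:R * ((#|V| ^ #|W|)%:R * (1 - #|F|%:R^-1)) :> R.
  have -> : #|Q| = (\sum_(I : {set W} | #|I| == k) #|[set u : {ffun W -> V} | colour I u != 0%R]|)%N.
    under [RHS]eq_bigr do rewrite -sum1dep_card.
    by rewrite pair_big_dep -sum1_card; apply: eq_bigl => x; rewrite inE.
  rewrite natr_sum (eq_bigr (fun=> (#|V| ^ #|W|)%:R * (1 - #|F|%:R^-1))) => [|I /eqP]; last exact: nonzero.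
  rewrite sumr_const -[LHS]mulr_natl; congr (_%:R * _).
  by rewrite -card_draws; apply: eq_card => I; rewrite !inE.
have Qle : (#|Q| <= #|coloured| * #|V| ^ (#|W| - k))%N.
  rewrite -sum1_card (partition_big (fun x => pgraph x.1 x.2) (mem coloured)) /=; last first.
    by move=> x xQ; apply: imset_f.
  rewrite -sum_nat_const; apply: leq_sum => S SC; rewrite sum1dep_card.
  case/imsetP: (SC) => -[I u]; rewrite inE /= => /andP[/eqP cI _] ->.
  rewrite -[X in (_ ^ (_ - X))%N]cI -(card_ffun_fixed I u).
  apply: leq_trans (leq_imset_card (fun y => (I, y)) _); apply: subset_leq_card.
  apply/subsetP => -[J w]; rewrite inE /= => /andP[_ /eqP/pgraph_inj[-> e]].
  apply: imset_f; rewrite inE; apply/forall_inP => i iI; by rewrite e.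
have VR : 0 < (#|V| ^ (#|W| - k))%:R :> R by rewrite ltr0n expn_gt0 V0.
rewrite -(ler_pM2r VR); apply: (@le_trans _ _ #|Q|%:R); last by rewrite -natrM ler_nat.
rewrite cQ le_eqVlt; apply/orP; left; apply/eqP.
have -> : (#|V| ^ #|W|)%:R = (#|V| ^ k)%:R * (#|V| ^ (#|W| - k))%:R :> R.
  by rewrite -natrM -expnD subnKC.
ring.
Qed.

End ColouredGraph.

Local Close Scope ring_scope.

(** * The hypergraph of copies in a blow-up of the host *)

Section Host.
Variables (k : nat) (W X0 : finType) (G : {set {set W}}) (L : {set {set X0}}) (i0 : W -> X0).
Hypotheses (k_gt0 : 0 < k) (cardG : forall I, I \in G -> #|I| = k) (i0_inj : injective i0).
Hypothesis i0L : forall I : {set W}, #|I| = k -> (i0 @: I \in L) = (I \in G).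
Hypothesis cardL : forall S, S \in L -> #|S| = k.
Hypothesis transL : forall S S', S \in L -> S' \in L ->
  exists s : {perm X0}, (forall A : {set X0}, (s @: A \in L) = (A \in L)) /\ s @: S = S'.

Definition autb (s : {perm X0}) := [forall A : {set X0}, (s @: A \in L) == (A \in L)].

Definition placement : finType := {s : {perm X0} | autb s}.

Definition place (s : placement) (j : W) : X0 := val s (i0 j).

Lemma place_inj s : injective (place s).
Proof. by move=> i j /perm_inj /i0_inj. Qed.

Lemma place_imset (s : placement) (I : {set W}) : place s @: I = val s @: (i0 @: I).
Proof. by rewrite -imset_comp. Qed.

Lemma placeL (s : placement) (I : {set W}) : #|I| = k -> (place s @: I \in L) = (I \in G).
Proof.
by move=> cI; rewrite place_imset -i0L //; have /forallP/(_ (i0 @: I))/eqP := valP s.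
Qed.

Definition placements (S : {set X0}) : {set placement} :=
  [set s | [exists I in G, place s @: (I : {set W}) == S]].

(** Composition with an automorphism carrying [S] to [S'] is injective. Used both ways, it makes the
    number of placements the same for all edges, which is what edge-transitivity is for. *)
Lemma placements_le S S' : S \in L -> S' \in L -> #|placements S| <= #|placements S'|.
Proof.
move=> SL SL'; have [phi [phiL ephi]] := transL SL SL'.
have aut_mul (s : placement) : autb (val s * phi)%g.
  apply/forallP => A; rewrite (_ : (val s * phi)%g @: A = phi @: (val s @: A)); last first.
    by rewrite -imset_comp; apply: eq_imset => x /=; rewrite permM.
  by rewrite phiL; have /forallP/(_ A) := valP s.
pose m (s : placement) : placement := Sub (val s * phi)%g (aut_mul s).
have m_inj : injective m.
  by move=> s s' /(congr1 val) /= /mulIg /val_inj.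
rewrite -(card_imset _ m_inj); apply/subset_leq_card/subsetP => _ /imsetP[s + ->].
rewrite !inE => /exists_inP[I IG /eqP eI]; apply/exists_inP; exists I => //.
rewrite -ephi -eI !place_imset -!imset_comp; apply/eqP/eq_imset => x /=.
by rewrite permM.
Qed.

Lemma placements_gt0 S : S \in L -> G != set0 -> 0 < #|placements S|.
Proof.
move=> SL /set0Pn[I IG]; have IL : i0 @: I \in L by rewrite i0L ?cardG.
apply: leq_trans (placements_le IL SL); apply/card_gt0P.
have a1 : autb 1%g.
  by apply/forallP => A; rewrite (eq_imset (g := id)) ?imset_id // => x; rewrite perm1.
exists (Sub 1%g a1); rewrite inE; apply/exists_inP; exists I => //.
by rewrite place_imset (eq_imset (g := id)) ?imset_id // => x /=; rewrite perm1.
Qed.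

Variables (Y : finType) (y0 : Y).

Definition hedge : finType := (placement * {ffun W -> Y})%type.

Definition emb (c : hedge) (j : W) : X0 * Y := (place c.1 j, c.2 j).

Lemma emb_inj c : injective (emb c).
Proof. by move=> i j [/place_inj]. Qed.

Lemma fst_emb c (I : {set W}) : fst @: (emb c @: I) = place c.1 @: I.
Proof. by rewrite -imset_comp. Qed.

Definition hinc (c : hedge) : {set {set X0 * Y}} := [set emb c @: (I : {set W}) | I in G].

(** The edges of the blow-up are the vertices of the hypergraph to be packed. Members of [L] have
    [k] elements, so [fst] is injective on each such [S]. *)
Definition hverts : {set {set X0 * Y}} :=
  [set S : {set X0 * Y} | (#|S| == k) && (fst @: S \in L)].

Lemma card_emb_set c (I : {set W}) : #|emb c @: I| = #|I|.
Proof. by rewrite card_imset //; apply: emb_inj. Qed.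

Lemma hinc_card c : #|hinc c| = #|G|.
Proof. by rewrite card_imset //; apply: imset_inj; apply: emb_inj. Qed.

Lemma hinc_sub c : hinc c \subset hverts.
Proof.
apply/subsetP => _ /imsetP[I IG ->]; have cI := cardG IG.
by rewrite inE card_emb_set cI eqxx fst_emb placeL.
Qed.

(** A placement determines the [k]-set of [W] lying over [S] and its [Y]-coordinates; the other
    [|W| - k] coordinates are free. *)
Lemma hinc_deg S0 S : S0 \in L -> S \in hverts ->
  #|[set c | S \in hinc c]| = #|placements S0| * #|Y| ^ (#|W| - k).
Proof.
move=> S0L; rewrite inE => /andP[/eqP cS SL].
have inj1 : {in S &, injective fst}.
  by apply/imset_injP; rewrite cS cardL.
have -> : #|placements S0| = #|placements (fst @: S)|.
  by apply/eqP; rewrite eqn_leq !placements_le.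
pose h x := odflt y0 [pick y | (x, y) \in S].
have hP x y : (x, y) \in S -> h x = y.
  move=> xy; rewrite /h; case: pickP => [y' xy'|/(_ y)]; last by rewrite xy.
  by have [] := inj1 _ _ xy' xy erefl.
have hS x : x \in fst @: S -> (x, h x) \in S.
  by case/imsetP => -[x' y] xy /= ->; rewrite (hP _ _ xy).
rewrite -sum1_card (partition_big fst (mem (placements (fst @: S)))) /=; last first.
  move=> c; rewrite !inE => /imsetP[I IG eS]; apply/exists_inP; exists I => //.
  by rewrite eS fst_emb.
rewrite -sum_nat_const; apply: eq_bigr => s; rewrite inE => /exists_inP[I IG /eqP eI].
rewrite sum1dep_card -[in RHS](cardG IG) -(card_ffun_fixed I (fun i => h (place s i))).
rewrite -[RHS](card_imset _ (f := pair s)); last by move=> ? ? [].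
apply: eq_card => -[s' y]; rewrite !inE /=; apply/andP/imsetP => [[/imsetP[J JG eS] /eqP es]|[y']]; last first.
  rewrite inE => /forall_inP yh [-> ->]; split=> //; apply/imsetP; exists I => //.
  apply/eqP; rewrite eq_sym eqEcard card_emb_set cS cardG // leqnn andbT.
  apply/subsetP => _ /imsetP[i iI ->]; rewrite /emb /= (eqP (yh i iI)); apply: hS.
  by rewrite -eI; apply: imset_f.
exists y; last by rewrite es.
have eJI : J = I.
  by apply: (imset_inj (@place_inj s)); rewrite eI eS fst_emb es.
rewrite inE; apply/forall_inP => i iI; rewrite eq_sym; apply/eqP; apply: hP.
by rewrite eS eJI -es; apply: imset_f.
Qed.

(** Distinct [S], [S'] come from distinct [I], [I'], whose union fixes at least [k + 1] coordinates.
    The factor [|Y|] lost against the degree makes [K / D] small. *)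
Lemma hinc_codeg S S' : S != S' ->
  #|[set c | (S \in hinc c) && (S' \in hinc c)]| <= #|placement| * #|Y| ^ (#|W| - k - 1).
Proof.
move=> SS'; have Y0 : 0 < #|Y| by apply/card_gt0P; exists y0.
rewrite -sum1_card (partition_big fst xpredT) //= -[#|placement|]cardsT -sum_nat_const.
rewrite [leqRHS](eq_bigl xpredT) => [|s]; last by rewrite inE.
apply: leq_sum => s _; rewrite sum1dep_card; set Q := [set _ | _].
have [Q0|[[s1 y1]]] := set_0Vmem Q; first by rewrite Q0 cards0.
rewrite !inE /= => /andP[/andP[/imsetP[I IG eS] /imsetP[I' IG' eS']] /eqP e1].
rewrite e1 in eS eS' => {s1 e1}.
have II' : I != I' by apply: contraNneq SS' => e; rewrite eS eS' e.
have cU : k < #|I :|: I'|.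
  rewrite ltn_neqAle -(cardG IG) subset_leq_card ?subsetUl // andbT.
  apply: contraNneq II' => e; have /eqP eU : I == I :|: I' by rewrite eqEcard subsetUl e leqnn.
  by rewrite eq_sym eqEcard (cardG IG) (cardG IG') leqnn andbT eU subsetUr.
apply: (@leq_trans (#|Y| ^ (#|W| - #|I :|: I'|))); last first.
  by rewrite leq_pexp2l // -subnDA addn1 leq_sub2l.
rewrite -(card_ffun_fixed (I :|: I') y1) -[leqRHS](card_imset _ (f := pair s)); last by move=> ? ? [].
apply/subset_leq_card/subsetP => -[s2 y]; rewrite !inE /=.
move=> /andP[/andP[/imsetP[J JG eJ] /imsetP[J' JG' eJ']] /eqP es]; rewrite es in eJ eJ' *.
apply: imset_f; rewrite inE; apply/forall_inP => i.
have agree (K K' : {set W}) : emb (s, y1) @: K = emb (s, y) @: K' -> i \in K -> y i = y1 i.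
  move=> e iK; have : emb (s, y1) i \in emb (s, y) @: K' by rewrite -e; apply: imset_f.
  by case/imsetP => j _ [/place_inj -> ->].
rewrite inE => /orP[iI|iI]; apply/eqP.
  by apply: (agree I J) => //; rewrite -eS.
by apply: (agree I' J') => //; rewrite -eS'.
Qed.

Lemma hverts_card : #|L| * #|Y| ^ k <= #|hverts|.
Proof.
pose Q := [set x : {set X0} * {ffun X0 -> Y} | (x.1 \in L) && [forall i in ~: x.1, x.2 i == y0]].
pose m (x : {set X0} * {ffun X0 -> Y}) : {set X0 * Y} := [set (i, x.2 i) | i in x.1].
have fm x : fst @: m x = x.1 by rewrite -imset_comp (eq_imset (g := id)) ?imset_id.
have m_inj : {in Q &, injective m}.
  move=> [S h] [S' h']; rewrite !inE /= => /andP[SL /forall_inP hS] /andP[SL' /forall_inP hS'] e.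
  have eS : S = S' by rewrite -[S](fm (S, h)) e fm.
  rewrite -eS in hS' e *; congr pair; apply/ffunP => i; case: (boolP (i \in S)) => iS; last first.
    by rewrite (eqP (hS i _)) ?(eqP (hS' i _)) // inE.
  have : (i, h i) \in m (S, h') by rewrite -e; apply: imset_f.
  by case/imsetP => j jS [->].
have -> : #|L| * #|Y| ^ k = #|Q|.
  rewrite -sum_nat_const -[RHS]sum1_card (partition_big fst (mem L)) /=; last by move=> x; rewrite inE => /andP[].
  apply: eq_bigr => S SL; rewrite sum1dep_card.
  have -> : #|Y| ^ k = #|Y| ^ (#|X0| - #|~: S|) by rewrite -(cardsC S) addnK cardL.
  rewrite -(card_ffun_fixed (~: S) (fun=> y0)) -[LHS](card_imset _ (f := pair S)); last by move=> ? ? [].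
  apply: eq_card => -[S' h]; rewrite !inE /=; apply/imsetP/idP => [[h']|/andP[/andP[_ hS] /eqP eS]].
    by rewrite inE => hh [-> ->]; rewrite SL eqxx hh.
  by exists h; rewrite ?eS // inE -eS.
rewrite -(card_in_imset m_inj); apply/subset_leq_card/subsetP => _ /imsetP[x + ->].
rewrite !inE => /andP[xL _]; rewrite fm xL andbT /m card_imset ?cardL // => i j [] //.
Qed.

Lemma host_regular S0 : S0 \in L ->
  regular_hypergraph hinc hverts #|G| (#|placements S0| * #|Y| ^ (#|W| - k))
    (#|placement| * #|Y| ^ (#|W| - k - 1)).
Proof.
move=> S0L; split.
- exact: hinc_card.
- exact: hinc_sub.
- by move=> S; apply: hinc_deg.
- exact: hinc_codeg.
Qed.

End Host.

(** * Lower bound *)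

Lemma maxCancellative_ge s n r (H : {set {set 'I_n}}) :
  rgraph r H -> cancellative s H -> #|H| <= maxCancellative s n r.
Proof.
move=> rH cH; rewrite /maxCancellative.
by apply: (@leq_bigmax_cond _ (fun H => rgraph r H && cancellative s H) (fun H => #|H|)); rewrite rH.
Qed.

Section HostCopies.
Variables (t k n : nat) (W X0 Y : finType) (F : {set {set W}}) (L : {set {set X0}}) (i0 : W -> X0).
Hypotheses (t2 : 2 <= t) (k2 : 2 <= k) (gF : gadget t k F) (i0_inj : injective i0).
Let G := shadow k F.
Hypothesis i0L : forall I : {set W}, #|I| = k -> (i0 @: I \in L) = (I \in G).
Hypothesis cardL : forall S, S \in L -> #|S| = k.
Variable M : {set hedge W L Y}.
Hypothesis M_disj : forall c d, c \in M -> d \in M -> c != d ->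
  [disjoint hinc G i0 c & hinc G i0 d].
Hypothesis M_sparse : forall B, B \in crowded Y (@place _ _ L i0) k (2 * t) -> ~~ (B \subset M).
Hypothesis n_ge : #|{: X0 * Y}| <= n.

Let f (x : X0 * Y) : 'I_n := widen_ord n_ge (enum_rank x).

Let f_inj : injective f.
Proof. by move=> x y /(congr1 val) /= /val_inj /enum_rank_inj. Qed.

Let femb (c : hedge W L Y) (j : W) : 'I_n := f (emb i0 c j).

Lemma card_shadow I : I \in G -> #|I| = k.
Proof. by rewrite inE => /andP[/eqP]. Qed.

(** The direction from [L] to [G] in [i0L] is decisive: a common [k]-set projects to an edge of [L]
    because of [d], so it is a shadow set of [c] too, against [M_disj]. *)
Lemma hedges_meet c d A : c \in M -> d \in M -> c != d -> A \in F ->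
  #|emb i0 d @: A :&: emb i0 c @: W| < k.
Proof.
move=> cM dM cd AF; rewrite ltnNge; apply/negP => kle.
have embI (e : hedge W L Y) : injective (emb i0 e) by exact: emb_inj.
have [S /andP[SS /eqP cS]] : exists S : {set X0 * Y},
    (S \subset emb i0 d @: A :&: emb i0 c @: W) && (#|S| == k).
  have : 0 < #|[set S : {set X0 * Y} | (S \subset emb i0 d @: A :&: emb i0 c @: W) & (#|S| == k)]|.
    by rewrite cards_draws bin_gt0.
  by case/card_gt0P => S; rewrite inE; exists S.
move: SS; rewrite subsetI => /andP[Sd Sc].
have preS (e : hedge W L Y) : S \subset emb i0 e @: W -> S = emb i0 e @: (emb i0 e @^-1: S).
  move=> Se; apply/setP => x; apply/idP/imsetP => [xS|[w]]; last by rewrite inE => ? ->.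
  by have /imsetP[w _ ex] := subsetP Se x xS; exists w; rewrite // inE -ex.
have cpre (e : hedge W L Y) : S \subset emb i0 e @: W -> #|emb i0 e @^-1: S| = k.
  by move=> Se; rewrite -cS [in RHS](preS e Se) card_imset.
have Sd' : S \subset emb i0 d @: W.
  by apply: subset_trans Sd _; apply/subsetP => _ /imsetP[w _ ->]; apply: imset_f.
have dG : emb i0 d @^-1: S \in G.
  rewrite inE cpre // eqxx; apply/exists_inP; exists A => //.
  apply/subsetP => w; rewrite inE => /(subsetP Sd) /imsetP[w' w'A /embI ->//].
have Sd2 : S \in hinc G i0 d by apply/imsetP; exists (emb i0 d @^-1: S) => //; apply: preS.
have SL : fst @: S \in L.
  by have := subsetP (hinc_sub card_shadow i0_inj i0L d) S Sd2; rewrite inE => /andP[].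
have Sc2 : S \in hinc G i0 c.
  apply/imsetP; exists (emb i0 c @^-1: S); last exact: preS.
  by rewrite -(placeL i0L c.1) ?cpre // -fst_emb -preS.
by have := disjointFr (M_disj cM dM cd) Sc2; rewrite Sd2.
Qed.

Lemma host_copies : #|M| * #|F| <= maxCancellative (2 * (t - 1)) n (t * k).
Proof.
have fembI c : injective (femb c) by move=> i j /f_inj /(emb_inj i0_inj).
have fim c (A : {set W}) : femb c @: A = f @: (emb i0 c @: A) by rewrite -imset_comp.
have fimW c : femb c @: W = f @: (emb i0 c @: W) by rewrite -imset_comp.
have meet c d A : c \in M -> d \in M -> c != d -> A \in F ->
    #|femb d @: A :&: femb c @: W| < k.
  move=> cM dM cd AF; rewrite fim fimW -imsetI; last by move=> ? ? _ _; apply: f_inj.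
  by rewrite card_imset //; apply: hedges_meet.
have sparse (B : {set hedge W L Y}) : B \subset M -> 1 < #|B| <= 2 * t ->
    #|B| * (#|W| - k) + k <= #|\bigcup_(c in B) femb c @: W|.
  move=> BM B2.
  have -> : \bigcup_(c in B) femb c @: W = f @: (\bigcup_(c in B) emb i0 c @: W).
    apply/setP => x; apply/bigcupP/imsetP => [[c cB]|[z /bigcupP[c cB zc] ->]].
      rewrite fimW => /imsetP[z zc ->]; exists z => //; apply/bigcupP; exists c => //.
    by exists c => //; rewrite fimW; apply: imset_f.
  rewrite card_imset // leqNgt; apply/negP => lt.
  by have := M_sparse (B := B); rewrite inE B2 lt BM => /(_ isT).
rewrite -(card_copies t2 gF fembI meet); apply: maxCancellative_ge.
  exact: (rgraph_copies _ gF fembI).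
exact: (cancellative_copies t2 k2 gF fembI meet sparse).
Qed.

End HostCopies.

Local Open Scope ring_scope.

Lemma nat_above (R : archiRealFieldType) (x : R) :
  exists N : nat, forall n, (N <= n)%N -> x <= n%:R.
Proof.
exists (Num.truncn x).+1 => n Nn; have [x0|/ltW x0] := leP 0 x; last exact: le_trans x0 (ler0n _ _).
have /andP[_ /ltW h] := truncn_itv x0.
by apply: le_trans h _; rewrite ler_nat.
Qed.

Lemma bernoulli (R : realFieldType) (x : R) n : 0 <= x <= 1 -> 1 - n%:R * x <= (1 - x) ^+ n.
Proof.
move=> /andP[x0 x1]; elim: n => [|n IHn]; first by rewrite mul0r subr0 expr0.
rewrite exprS -natr1; have nx : 0 <= n%:R * x by rewrite mulr_ge0 ?ler0n.
have : (1 - x) * (1 - n%:R * x) <= (1 - x) * (1 - x) ^+ n by rewrite ler_wpM2l ?subr_ge0.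
by move=> h; apply: le_trans h; nra.
Qed.

Lemma bin_ge (R : archiRealFieldType) (k : nat) (delta : R) : 0 < delta ->
  exists N : nat, forall w, (N <= w)%N ->
  (1 - delta) * (w ^ k)%:R <= (k`! * 'C(w, k))%:R.
Proof.
move=> d0; have [N HN] := nat_above ((k ^ 2)%:R / delta).
exists (maxn N (maxn 1 k)) => w; rewrite !geq_max => /and3P[Nw w1 kw].
have w0 : 0 < w%:R :> R by rewrite ltr0n.
have h1 j : (j <= k)%N -> ((w - k) ^ j <= w ^_ j)%N.
  elim: j => // j IHj jk; rewrite ffactnSr expnSr; apply: leq_mul; first exact/IHj/ltnW.
  by apply: leq_sub2l; apply: ltnW.
apply: (@le_trans _ _ ((w - k) ^ k)%:R); last by rewrite ler_nat mulnC bin_ffact h1.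
rewrite !natrX natrB //.
have -> : w%:R - k%:R = w%:R * (1 - k%:R / w%:R) :> R by field; rewrite gt_eqF.
rewrite exprMn mulrC ler_wpM2l ?exprn_ge0 ?(ltW w0) //.
apply: le_trans (bernoulli k _); last first.
  by rewrite divr_ge0 ?ler0n //= ler_pdivrMr // mul1r ler_nat.
rewrite lerD2l lerN2 mulrA -natrM ler_pdivrMr // mulnn.
by have := HN w Nw; rewrite ler_pdivrMr // mulrC.
Qed.

Lemma lower_blowup (R : archiRealFieldType) (t k : nat) (delta : R) :
  (2 <= t)%N -> (2 <= k)%N -> 0 < delta -> 5 * delta <= 1 ->
  exists x0 y1 : nat, (0 < x0)%N /\ forall y n, (y1 <= y)%N -> (x0 * y <= n)%N ->
  (1 - 5 * delta) * ((x0 * y) ^ k)%:R <=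
  (k`! * 'C(t * k - 1, k - 1))%:R * (maxCancellative (2 * (t - 1)) n (t * k))%:R.
Proof.
move=> t2 k2 d0 d5.
have d1 : delta <= 1 by lra.
have d2 : 0 <= 1 - 2 * delta by lra.
(* Losses to come: [1 - 2 delta] from the nibble and the crowded families, [1 - delta] from the
   shadow of the gadget, [(1 - delta) ^ 2] from the density of the host. *)
have cubic : (1 - 5 * delta) <= (1 - 2 * delta) * (1 - 3%:R * delta) by nra.
have zle (z c : R) : c <= delta * z -> (1 - 2 * delta) * z <= z * (1 - delta) - c by lra.
set Cb := 'C(t * k - 1, k - 1).
have k0 : (0 < k)%N by apply: ltnW.
have ktk : (k < t * k)%N by rewrite ltn_Pmull.
have Cb0 : 0 < Cb%:R :> R by rewrite ltr0n bin_gt0 leq_sub2r // ltnW.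
have [m0 Hm0] := bin_ge k d0.
have dC : 0 < delta * Cb%:R by rewrite mulr_gt0.
have [W [F [gF F0 Wm GF]]] := gadget_exists m0 t2 k2 dC.
rewrite -/Cb in GF; set G := shadow k F in GF.
have [Np HNp] := nat_above delta^-1.
have [p Np_p p_pr] := prime_above Np.
have cFp : #|'F_p| = p by rewrite card_Fp.
have pinv : #|'F_p|%:R^-1 <= delta.
  rewrite cFp -[delta]invrK lef_pV2 ?posrE ?invr_gt0 ?ltr0n ?prime_gt0 //.
  exact/HNp/ltnW.
pose V := {ffun {set W} -> 'F_p}; pose X0 : finType := (W * V)%type.
have [u Hu] := coloured_embedding 'F_p k0 G.
pose L := coloured W 'F_p k; pose i0 (j : W) : X0 := (j, u j).
have i0_inj : injective i0 by move=> i j [].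
have i0L (I : {set W}) : #|I| = k -> (i0 @: I \in L) = (I \in G) by exact: Hu.
have cG I : I \in G -> #|I| = k by rewrite inE => /andP[/eqP].
have cL S : S \in L -> #|S| = k by exact: card_coloured.
have tL := @coloured_transitive W 'F_p k.
have [I0 I0G] : exists I, I \in G.
  have /set0Pn[A AF] := F0; have cA := gadget_card gF AF.
  have : (0 < #|[set I : {set W} | I \subset A & #|I| == k]|)%N.
    by rewrite cards_draws cA bin_gt0 ltnW.
  case/card_gt0P => I; rewrite inE => /andP[IA cI]; exists I.
  by rewrite inE cI; apply/exists_inP; exists A.
have G_0 : G != set0 by apply/set0Pn; exists I0.
pose S0 := i0 @: I0; have S0L : S0 \in L by rewrite i0L ?cG.
have g0 : (0 < #|G|)%N by rewrite card_gt0.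
have [[c b] [/= c0 b0] Hn] := nibble g0 d0.
pose D0 := #|@placements W X0 G L i0 S0|.
have D00 : (0 < D0)%N by apply: (placements_gt0 cG i0L tL).
pose P0 := #|placement L|.
have kW : (k < #|W|)%N.
  have /set0Pn[A AF] := F0; apply: leq_trans (max_card A).
  by rewrite (gadget_card gF AF).
pose C1 : R := crowded_const k (2 * t) (c / D0%:R) P0 #|W|.
have L0 : 0 < #|L|%:R :> R by rewrite ltr0n; apply/card_gt0P; exists S0.
have G0 : 0 < #|G|%:R :> R by rewrite ltr0n.
(* The three thresholds control [1 / D], the ratio [K / D], and the loss to crowded families against
   the order [y ^ k]. *)
have [y1 Hy1] := nat_above b^-1.
have [y2 Hy2] := nat_above (P0%:R / b).
have [y3 Hy3] := nat_above (C1 * #|G|%:R / (delta * #|L|%:R)).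
exists #|X0|, (maxn 1 (maxn y1 (maxn y2 y3))); split.
  have [w _] : exists w, w \in I0 by apply/card_gt0P; rewrite cG.
  by apply/card_gt0P; exists (i0 w).
move=> y n; rewrite !geq_max => /and4P[y_1 y1y y2y y3y] n_ge.
have y_0 : 0 < y%:R :> R by rewrite ltr0n.
have y0 : 'I_y by exists 0%N.
pose D := (D0 * #|'I_y| ^ (#|W| - k))%N.
pose K := (P0 * #|'I_y| ^ (#|W| - k - 1))%N.
have rh := host_regular cG i0_inj i0L cL tL y0 S0L.
have Dpos : (0 < D)%N by rewrite muln_gt0 D00 expn_gt0 card_ord y_1.
have DR : 0 < D%:R :> R by rewrite ltr0n.
have eDy : (#|'I_y| ^ (#|W| - k) = y * #|'I_y| ^ (#|W| - k - 1))%N.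
  by rewrite card_ord -expnS subn1 prednK // subn_gt0.
have Dinv : D%:R^-1 <= b.
  rewrite -[b]invrK lef_pV2 ?posrE ?invr_gt0 //; apply: le_trans (Hy1 y y1y) _.
  by rewrite ler_nat /D eDy mulnCA leq_pmulr // muln_gt0 D00 expn_gt0 card_ord y_1.
have KD : K%:R / D%:R <= b.
  rewrite ler_pdivrMr // /K /D eDy mulnCA !natrM.
  rewrite [b * _](_ : _ = (b * y%:R) * (D0%:R * (#|'I_y| ^ (#|W| - k - 1))%:R)); last by ring.
  have yp : 0 <= (#|'I_y| ^ (#|W| - k - 1))%:R :> R by rewrite ler0n.
  have Pb : P0%:R <= b * y%:R by have := Hy2 y y2y; rewrite ler_pdivrMr // mulrC.
  rewrite mulrA ler_wpM2r // -[leLHS]mulr1 ler_pM ?ler0n // ler1n.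
  exact: D00.
pose BB := crowded 'I_y (@place _ _ L i0) k (2 * t).
have [M [M1 M2 M3]] := Hn _ _ _ _ D K BB Dpos rh Dinv KD (crowded_set0 _ _ _ _).
have n_ge' : (#|{: X0 * 'I_y}| <= n)%N by rewrite card_prod card_ord.
have hc := host_copies t2 k2 gF i0_inj i0L M1 M2 n_ge'.
have wt := crowded_weight (@place _ _ L i0) (2 * t) y0 k2 (divr_ge0 (ltW c0) (ler0n R D0)).
have eDD : c / D%:R = c / D0%:R / (#|'I_y| ^ (#|W| - k))%:R.
  by rewrite /D natrM invfM mulrA.
rewrite -/BB -/P0 -/C1 -eDD card_ord in wt.
have N1 : #|L|%:R * (y ^ k)%:R <= #|hverts k L 'I_y|%:R :> R.
  by rewrite -natrM ler_nat; have := hverts_card cL y0; rewrite card_ord.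
have C1y : C1 * (y ^ k.-1)%:R <= delta * (#|L|%:R * (y ^ k)%:R / #|G|%:R).
  have := Hy3 y y3y; rewrite ler_pdivrMr ?mulr_gt0 // => h.
  rewrite -[in leRHS](prednK k0) expnS natrM.
  rewrite [leRHS](_ : _ = (y%:R * (delta * #|L|%:R) / #|G|%:R) * (y ^ k.-1)%:R); last by ring.
  by rewrite ler_wpM2r ?ler0n // ler_pdivlMr.
have Mle : (1 - 2 * delta) * (#|L|%:R * (y ^ k)%:R / #|G|%:R) <= #|M|%:R.
  apply: le_trans M3; apply: (@le_trans _ _ (#|L|%:R * (y ^ k)%:R / #|G|%:R * (1 - delta) - C1 * (y ^ k.-1)%:R)).
    exact: zle.
  apply: lerB => //; rewrite ler_wpM2r ?subr_ge0 // ler_wpM2r ?invr_ge0 ?ler0n //.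
have Lge := card_coloured_ge W 'F_p k0 R.
have Wge := Hm0 _ Wm.
have V0 : 0 <= (#|V| ^ k)%:R :> R by rewrite ler0n.
have k_0 : 0 < k`!%:R :> R by rewrite ltr0n fact_gt0.
set W_k := (#|W| ^ k)%:R in Wge; have Wk0 : 0 <= W_k by rewrite ler0n.
have cX : #|X0| = (#|W| * #|V|)%N by rewrite card_prod.
have Lk : (1 - delta) ^+ 2 * (#|X0| ^ k)%:R <= k`!%:R * #|L|%:R.
  apply: le_trans (_ : k`!%:R * ('C(#|W|, k)%:R * (#|V| ^ k)%:R * (1 - #|'F_p|%:R^-1)) <= _); last first.
    by rewrite ler_wpM2l // ltW.
  rewrite cX expnMn natrM -/W_k.
  rewrite [leLHS](_ : _ = (1 - delta) * W_k * (#|V| ^ k)%:R * (1 - delta)); last by ring.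
  rewrite [leRHS](_ : _ = (k`! * 'C(#|W|, k))%:R * (#|V| ^ k)%:R * (1 - #|'F_p|%:R^-1));
    last by rewrite natrM; ring.
  apply: ler_pM; rewrite ?mulr_ge0 ?subr_ge0 //.
    by rewrite ler_wpM2r.
  by rewrite lerD2l lerN2.
have Fge : (1 - delta) * #|G|%:R <= #|F|%:R * Cb%:R.
  have Fn : 0 <= #|F|%:R * Cb%:R :> R by rewrite mulr_ge0 ?ler0n.
  have : (1 - delta) * #|G|%:R <= (1 - delta) * (#|F|%:R * (Cb%:R + delta * Cb%:R)).
    by rewrite ler_wpM2l ?subr_ge0.
  move=> h; apply: le_trans h _.
  rewrite (_ : _ * _ = (1 - delta ^+ 2) * (#|F|%:R * Cb%:R)); last by ring.
  by rewrite ler_piMl // lerBlDr lerDl sqr_ge0.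
apply: (@le_trans _ _ ((k`! * Cb)%:R * (#|M| * #|F|)%:R)); last first.
  by rewrite ler_wpM2l ?ler0n // ler_nat.
rewrite !natrM expnMn natrM.
set Xk := (#|X0| ^ k)%:R in Lk *; set yk := (y ^ k)%:R in Mle *.
have yk0 : 0 <= yk by rewrite ler0n.
have Xk0 : 0 <= Xk by rewrite ler0n.
have s1 : (1 - 2 * delta) * (#|L|%:R * yk / #|G|%:R) * (#|F|%:R * Cb%:R) <= #|M|%:R * (#|F|%:R * Cb%:R).
  by rewrite ler_wpM2r ?mulr_ge0 ?ler0n.
have s2 : (1 - 2 * delta) * (#|L|%:R * yk / #|G|%:R) * ((1 - delta) * #|G|%:R) <=
   (1 - 2 * delta) * (#|L|%:R * yk / #|G|%:R) * (#|F|%:R * Cb%:R).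
  by rewrite ler_wpM2l // mulr_ge0 // divr_ge0 ?mulr_ge0 ?ler0n.
have es2 : (1 - 2 * delta) * (#|L|%:R * yk / #|G|%:R) * ((1 - delta) * #|G|%:R) =
    (1 - 2 * delta) * (1 - delta) * yk * #|L|%:R.
  by field; rewrite gt_eqF.
rewrite es2 in s2.
have s3 : (1 - 2 * delta) * (1 - delta) * yk * ((1 - delta) ^+ 2 * Xk) <=
   (1 - 2 * delta) * (1 - delta) * yk * (k`!%:R * #|L|%:R).
  by rewrite ler_wpM2l // !mulr_ge0 // subr_ge0.
have s4 : (1 - 5 * delta) * (Xk * yk) <= (1 - 2 * delta) * (1 - delta) * yk * ((1 - delta) ^+ 2 * Xk).
  rewrite [leRHS](_ : _ = ((1 - 2 * delta) * (1 - delta) ^+ 3) * (Xk * yk)); last by ring.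
  rewrite ler_wpM2r ?mulr_ge0 //.
  have := bernoulli 3 (_ : 0 <= delta <= 1); rewrite ltW // d1 => /(_ isT) b3.
  exact: le_trans cubic (ler_wpM2l d2 b3).
apply: le_trans s4 _; apply: le_trans s3 _.
have s5 := ler_wpM2l (ltW k_0) (le_trans s2 s1).
apply: le_trans (_ : k`!%:R * ((1 - 2 * delta) * (1 - delta) * yk * #|L|%:R) <= _).
  by rewrite le_eqVlt; apply/orP; left; apply/eqP; ring.
apply: le_trans s5 _; rewrite le_eqVlt; apply/orP; left; apply/eqP; ring.
Qed.

Lemma maxCancellative_lower (R : archiRealFieldType) (t k : nat) (eta : R) :
  (2 <= t)%N -> (2 <= k)%N -> 0 < eta -> exists N : nat, forall n, (N <= n)%N ->
  (1 - eta) * n%:R ^+ k <=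
  (k`! * 'C(t * k - 1, k - 1))%:R * (maxCancellative (2 * (t - 1)) n (t * k))%:R.
Proof.
move=> t2 k2.
wlog eta1 : eta / eta <= 1.
  move=> h e0; have [|gt] := leP eta 1; first by move=> le; apply: h.
  exists 0%N => n _; apply: (@le_trans _ _ 0); last by rewrite mulr_ge0 ?ler0n.
  by rewrite mulr_le0_ge0 ?exprn_ge0 ?ler0n // subr_le0 ltW.
(* The blow-up costs [5 d = eta / 2], and rounding [n] down to a multiple of [x0] another
   [eta / 2]. *)
move=> e0; pose d := eta / 10.
have d0 : 0 < d by rewrite divr_gt0.
have d5 : 5 * d <= 1 by rewrite /d; lra.
have [x0 [y1 [x0_gt0 H]]] := lower_blowup t2 k2 d0 d5.
have [N1 HN1] := nat_above (2 * k%:R * x0%:R / eta).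
exists (maxn (maxn 1 x0) (maxn N1 (x0 * y1)))%N => n; rewrite !geq_max.
move=> /andP[/andP[n1 x0n] /andP[N1n yn]].
have yle : (y1 <= n %/ x0)%N by rewrite leq_divRL // mulnC.
have xn : (x0 * (n %/ x0) <= n)%N by rewrite mulnC leq_trunc_div.
apply: le_trans (H _ _ yle xn).
have n0 : 0 < n%:R :> R by rewrite ltr0n.
have ge : n%:R - x0%:R <= (x0 * (n %/ x0))%:R :> R.
  rewrite lerBlDr -natrD ler_nat {1}(divn_eq n x0) mulnC leq_add2l.
  by rewrite ltnW // ltn_pmod.
have q01 : 0 <= (x0%:R / n%:R : R) <= 1.
  by apply/andP; split; [apply: divr_ge0 | rewrite ler_pdivrMr // mul1r ler_nat].
have h1 : (1 - eta / 2) * n%:R ^+ k <= ((x0 * (n %/ x0)) ^ k)%:R.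
  apply: (@le_trans _ _ ((n%:R * (1 - x0%:R / n%:R)) ^+ k)); last first.
    rewrite natrX lerXn2r ?nnegrE ?ler0n ?mulr_ge0 ?subr_ge0 ?ler0n //; first by case/andP: q01.
    by rewrite mulrBr mulr1 mulrC divfK // gt_eqF.
  rewrite exprMn mulrC ler_wpM2l ?exprn_ge0 ?ler0n //.
  apply: le_trans (bernoulli k q01); rewrite lerD2l lerN2 mulrA.
  rewrite ler_pdivrMr //; have := HN1 n N1n; rewrite ler_pdivrMr //; lra.
have c0 : 0 <= 1 - 5 * d by rewrite subr_ge0.
apply: le_trans (ler_wpM2l c0 h1); rewrite mulrA ler_wpM2r ?exprn_ge0 ?ler0n //.
rewrite /d; nra.
Qed.

Local Close Scope ring_scope.

(** * Upper bound *)

(** Cancellativity speaks of exactly [s] distinct edges, so a smaller cover is padded with other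
    edges of [H]; the size of [H] guarantees enough of them besides [B] and [C]. *)
Lemma cancellative_cover (T : finType) s (H AA : {set {set T}}) (B C : {set T}) :
  cancellative s H -> s.+1 < #|H| -> B \in H -> C \in H -> B != C ->
  AA \subset H -> B \notin AA -> C \notin AA -> #|AA| <= s ->
  ~~ (symdiff B C \subset cover AA).
Proof.
move=> cH sH BH CH BC AAH BN CN cA; apply/negP => sub.
pose D := H :\: (AA :|: [set B; C]).
have cD : s - #|AA| <= #|D|.
  have e := cardsID (AA :|: [set B; C]) H.
  have le1 : #|H :&: (AA :|: [set B; C])| <= #|AA| + 2.
    apply: leq_trans (subset_leq_card (subsetIr _ _)) _.
    by apply: leq_trans (leq_card_setU _ _) _; rewrite cards2 BC.
  by move: e le1 sH; rewrite -/D; clear; lia.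
have [D' D'D cD'] : exists2 D' : {set {set T}}, D' \subset D & #|D'| = s - #|AA|.
  have : 0 < #|[set D' : {set {set T}} | D' \subset D & #|D'| == s - #|AA|]|.
    by rewrite cards_draws bin_gt0.
  by case/card_gt0P => D'; rewrite inE => /andP[? /eqP ?]; exists D'.
have dis : [disjoint AA & D'].
  rewrite disjoint_sym (disjointWl D'D) // disjoints_subset; apply/subsetP => x.
  by rewrite !inE negb_or => /andP[/andP[]].
have cAA : #|AA :|: D'| = s by rewrite cardsU disjoint_setI0 // cards0 subn0 cD' subnKC.
have sz : size (enum (AA :|: D')) == s by rewrite -cardE cAA.
pose A : s.-tuple {set T} := Tuple sz.
have mA x : (x \in A) = (x \in AA :|: D') by rewrite memtE /= mem_enum.
have /forallP/(_ A)/forallP/(_ B)/forallP/(_ C)/implyP := cH.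
have DN x : x \in D' -> [/\ x \in H, x != B & x != C].
  by move/(subsetP D'D); rewrite !inE !negb_or => /andP[/and3P[_ -> ->] ->].
case/(_ _)/negP.
  rewrite BH CH /= in_cons negb_or BC !mA !in_setU !negb_or BN CN /= enum_uniq andbT.
  apply/and3P; split.
  - apply/allP => x; rewrite mA in_setU => /orP[/(subsetP AAH)//|/DN[]//].
  - by apply/negP => /DN[_]; rewrite eqxx.
  - by apply/negP => /DN[_ _]; rewrite eqxx.
have eU : \bigcup_(i < s) tnth A i = cover (AA :|: D').
  rewrite /cover; apply/setP => x; apply/bigcupP/bigcupP => [[i _ xi]|[E]].
    by exists (tnth A i) => //; rewrite -mA mem_tnth.
  by rewrite -mA => /tnthP[i ->] xi; exists i.
have sub' : symdiff B C \subset cover (AA :|: D').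
  by apply: subset_trans sub _; rewrite /cover bigcup_setU subsetUl.
rewrite eU; apply/eqP/setP => x; rewrite !(in_setU x (cover _)).
have := subsetP sub' x; rewrite in_setU !in_setD.
case: (x \in B); case: (x \in C) => //= ->; rewrite ?orbT //.
Qed.

Lemma imset_permM (T : finType) (s u : {perm T}) (A : {set T}) :
  (s * u)%g @: A = u @: (s @: A).
Proof. by rewrite -imset_comp; apply: eq_imset => x; rewrite /= permM. Qed.

Lemma imset_perm1 (T : finType) (A : {set T}) : (1%g : {perm T}) @: A = A.
Proof. by rewrite (eq_imset (g := id)) ?imset_id // => x; rewrite perm1. Qed.

Section Averaging.
Variables (t k : nat).
Local Notation Q := ('I_t * 'I_k)%type.

Definition row_of (i : 'I_t) : {set Q} := [set (i, j) | j : 'I_k].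

Lemma card_row i : #|row_of i| = k.
Proof. by rewrite card_imset ?card_ord // => j j' []. Qed.

(* Every permutation of [Q] sends some row into [F], while each [k]-set is the image of a given row
   under the same number of permutations. *)
Lemma rows_averaging (F : {set {set Q}}) : 0 < k -> 0 < t ->
  (forall S, S \in F -> #|S| = k) ->
  (forall s : {perm Q}, exists i, s @: row_of i \in F) ->
  'C(t * k - 1, k - 1) <= #|F|.
Proof.
move=> k0 t0 cF hF.
pose i0 := Ordinal t0.
pose c := #|[set s : {perm Q} | s @: row_of i0 == row_of i0]|.
have count (A B : {set Q}) : #|A| = k -> #|B| = k -> #|[set s : {perm Q} | s @: A == B]| = c.
  move=> cA cB.
  have [a ea] : exists a : {perm Q}, a @: row_of i0 = A by apply: perm_imset_eq; rewrite card_row.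
  have [b eb] : exists b : {perm Q}, b @: row_of i0 = B by apply: perm_imset_eq; rewrite card_row.
  have inj : injective (fun s : {perm Q} => a * s * b^-1)%g by move=> s s' /mulIg/mulgI.
  have eA : (a^-1)%g @: A = row_of i0 by rewrite -ea -imset_permM mulgV imset_perm1.
  have eB : (b^-1)%g @: B = row_of i0 by rewrite -eb -imset_permM mulgV imset_perm1.
  rewrite /c -[LHS](card_imset _ inj); apply: eq_card => s; rewrite [RHS]inE.
  apply/imsetP/eqP => [[s']|es].
    by rewrite inE => /eqP e ->; rewrite !imset_permM ea e eB.
  exists (a^-1 * s * b)%g; last by rewrite !mulgA mulgV mul1g mulgK.
  by rewrite inE !imset_permM eA es eb.
have tot (A : {set Q}) (E : {set {set Q}}) : #|A| = k -> (forall S, S \in E -> #|S| = k) ->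
    #|[set s : {perm Q} | s @: A \in E]| = #|E| * c.
  move=> cA cE; rewrite -sum1_card (partition_big (fun s : {perm Q} => s @: A) (mem E)) /=; last first.
    by move=> s; rewrite inE.
  rewrite -sum_nat_const; apply: eq_bigr => S SE; rewrite sum1dep_card -(count A S cA (cE S SE)).
  by apply: eq_card => s; rewrite !inE; apply: andb_idl => /eqP->.
have all_k : #|{perm Q}| = 'C(t * k, k) * c.
  rewrite -[t * k](_ : #|{: Q}| = _); last by rewrite card_prod !card_ord.
  rewrite -card_draws -(tot (row_of i0)) ?card_row //; last by move=> S; rewrite inE => /eqP.
  by apply: eq_card => s; rewrite !inE card_imset ?card_row ?eqxx //; apply: perm_inj.
have c0 : 0 < c by apply/card_gt0P; exists 1%g; rewrite inE imset_perm1.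
have le : #|{perm Q}| <= t * (#|F| * c).
  apply: (@leq_trans (#|\bigcup_(i : 'I_t) [set s : {perm Q} | s @: row_of i \in F]|)).
    apply: subset_leq_card; apply/subsetP => s _; have [i h] := hF s.
    by apply/bigcupP; exists i; rewrite // inE.
  apply: leq_trans (card_bigcup_le _ _) _.
  rewrite (eq_bigr (fun=> #|F| * c)) => [|i _]; last by rewrite tot ?card_row.
  by rewrite sum_nat_const card_ord.
rewrite all_k mulnA leq_pmul2r // in le.
have tk0 : 0 < t * k by rewrite muln_gt0 t0.
have eb : t * 'C(t * k - 1, k - 1) = 'C(t * k, k).
  apply/eqP; rewrite -(eqn_pmul2l k0); apply/eqP.
  have := mul_bin_diag (t * k) (k - 1).
  by rewrite !subn1 prednK // => <-; rewrite mulnA [k * t]mulnC.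
by rewrite -eb leq_pmul2l in le.
Qed.

End Averaging.

Section UpperBound.
Variables (t k : nat) (T : finType) (H : {set {set T}}).
Hypotheses (t0 : 0 < t) (k0 : 0 < k).
Hypotheses (rH : rgraph (t * k) H) (cH : cancellative (2 * (t - 1)) H) (H2t : 2 * t <= #|H|).

Definition unowned (A X : {set T}) := [exists B in H, (B != A) && (X \subset B)].

Definition unowned_cover (A : {set T}) (p : {ffun 'I_t -> {set T}}) :=
  [forall i, (#|p i| == k) && unowned A (p i)] && (\bigcup_i p i == A).

(* No [k]-set is charged to two edges: [t - 1] edges around each of two unowned covers sharing [X]
   would cover their symmetric difference. *)
Definition charged (A : {set T}) : {set {set T}} :=
  [set X : {set T} | [&& #|X| == k, X \subset A &
     ~~ unowned A X || [exists p, unowned_cover A p && [exists i, p i == X]]]].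

Lemma charged_disjoint A C X : A \in H -> C \in H -> X \in charged A -> X \in charged C -> A = C.
Proof.
move=> AH CH; rewrite !inE => /and3P[_ XA oA] /and3P[_ XC oC]; apply/eqP/negPn/negP => AC.
have uA : unowned A X by apply/exists_inP; exists C; rewrite // eq_sym AC.
have uC : unowned C X by apply/exists_inP; exists A; rewrite // AC.
rewrite uA /= in oA; rewrite uC /= in oC.
case/existsP: oA => p /andP[pA /existsP[i /eqP pi]].
case/existsP: oC => q /andP[qC /existsP[j /eqP qj]].
pose w (B Z : {set T}) : {set T} := odflt set0 [pick D in H | (D != B) && (Z \subset D)].
have wP (B Z : {set T}) : unowned B Z -> [/\ w B Z \in H, w B Z != B & Z \subset w B Z].
  move=> /exists_inP[D DH hD]; rewrite /w; case: pickP => [D' /andP[? /andP[? ?]]//|/(_ D)].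
  by rewrite DH hD.
pose side (B : {set T}) (r : {ffun 'I_t -> {set T}}) (l : 'I_t) := [set w B (r m) | m in [set~ l]].
have cside B r (l : 'I_t) : #|side B r l| <= t - 1.
  by apply: leq_trans (leq_imset_card _ _) _; rewrite cardsC1 card_ord subn1.
have sideH B (r : {ffun 'I_t -> {set T}}) (l : 'I_t) : unowned_cover B r -> side B r l \subset H.
  move=> /andP[/forallP ur _]; apply/subsetP => D /imsetP[m _ ->].
  by have /andP[_ /wP[]] := ur m.
have sideN B (r : {ffun 'I_t -> {set T}}) (l : 'I_t) : unowned_cover B r -> B \notin side B r l.
  move=> /andP[/forallP ur _]; apply/imsetP => -[m _ e].
  by have /andP[_ /wP[_]] := ur m; rewrite -e eqxx.
have side_cover (B D : {set T}) (r : {ffun 'I_t -> {set T}}) (l : 'I_t) : unowned_cover B r -> r l \subset D ->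
    B :\: D \subset cover (side B r l :\ D).
  move=> /andP[/forallP ur /eqP eB] rlD; apply/subsetP => v.
  rewrite in_setD => /andP[vD]; rewrite -{1}eB => /bigcupP[m _ vm].
  have /andP[_ /wP[_ _ sub]] := ur m.
  apply/bigcupP; exists (w B (r m)); last exact: (subsetP sub).
  rewrite in_setD1; apply/andP; split.
    by apply: contraNneq vD => <-; apply: (subsetP sub).
  apply/imsetP; exists m => [|//]; rewrite in_setC in_set1; apply: contraNneq vD => eml.
  by apply: (subsetP rlD); rewrite -eml.
pose AA := (side A p i :\ C) :|: (side C q j :\ A).
have cAA : #|AA| <= 2 * (t - 1).
  apply: leq_trans (leq_card_setU _ _) _; rewrite mul2n -addnn leq_add //.
    by apply: leq_trans (cside A p i); rewrite subset_leq_card // subD1set.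
  by apply: leq_trans (cside C q j); rewrite subset_leq_card // subD1set.
have AAH : AA \subset H.
  by rewrite subUset !(subset_trans (subD1set _ _)) ?sideH.
have AN : A \notin AA.
  by rewrite in_setU !in_setD1 eqxx /= orbF negb_and sideN ?orbT.
have CN : C \notin AA.
  by rewrite in_setU !in_setD1 eqxx /= negb_and sideN ?orbT.
have H2 : (2 * (t - 1)).+1 < #|H| by move: H2t t0; clear; lia.
have /negP := cancellative_cover cH H2 AH CH AC AAH AN CN cAA; apply.
rewrite /cover bigcup_setU /symdiff setUSS //.
  by apply: side_cover; rewrite // pi.
by apply: side_cover; rewrite // qj.
Qed.

(** [A] is identified with the grid, and the rows of a permuted grid decompose it. If every part
    lies in another edge, the decomposition is an unowned cover and any part, here the first, is
    charged. *)
Lemma card_charged A : A \in H -> 'C(t * k - 1, k - 1) <= #|charged A|.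
Proof.
move=> AH; have cA : #|A| = t * k by apply/eqP; exact: (forall_inP rH).
have cQ : #|{: 'I_t * 'I_k}| = #|A| by rewrite cA card_prod !card_ord.
pose phi (x : 'I_t * 'I_k) : T := enum_val (cast_ord cQ (enum_rank x)).
have phi_inj : injective phi by move=> x y /enum_val_inj /cast_ord_inj /enum_rank_inj.
have phiA x : phi x \in A by apply: enum_valP.
have phi_onto : phi @: setT = A.
  apply/eqP; rewrite eqEcard card_imset // cardsT cQ leqnn andbT.
  by apply/subsetP => _ /imsetP[x _ ->].
pose F := [set S : {set 'I_t * 'I_k} | phi @: S \in charged A].
have cF : #|F| <= #|charged A|.
  rewrite -(card_imset F (imset_inj phi_inj)); apply/subset_leq_card/subsetP => _ /imsetP[S + ->].
  by rewrite inE.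
apply: leq_trans cF; apply: rows_averaging => // [S|s].
  by rewrite !inE => /and3P[/eqP]; rewrite card_imset.
pose p := [ffun i : 'I_t => phi @: (s @: row_of k i)].
have cp i : #|p i| = k by rewrite ffunE (card_imset _ phi_inj) (card_imset _ (@perm_inj _ s)) card_row.
have pA i : p i \subset A by rewrite ffunE; apply/subsetP => _ /imsetP[x _ ->].
have inF i : p i \in charged A -> s @: row_of k i \in F by move=> h; rewrite inE; rewrite ffunE in h.
have [/existsP[i own]|none] := boolP [exists i, ~~ unowned A (p i)].
  by exists i; apply: inF; rewrite !inE cp eqxx pA own.
exists (Ordinal t0); apply: inF; rewrite inE cp eqxx pA /=.
apply/orP; right; apply/existsP; exists p; apply/andP; split; last by apply/existsP; exists (Ordinal t0).
apply/andP; split.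
  by apply/forallP => i; rewrite cp eqxx /=; move: none; rewrite negb_exists => /forallP/(_ i); rewrite negbK.
apply/eqP/setP => v; apply/bigcupP/idP => [[i _ vi]|vA]; first exact: (subsetP (pA i)).
have /imsetP[x _ ->] : v \in phi @: setT by rewrite phi_onto.
exists (s^-1 x)%g.1 => //; rewrite ffunE; apply: imset_f.
rewrite -{1}[x](permKV s); apply: imset_f.
by apply/imsetP; exists (s^-1 x)%g.2 => //; rewrite -surjective_pairing.
Qed.

Lemma upper_bound : #|H| * 'C(t * k - 1, k - 1) <= 'C(#|T|, k).
Proof.
rewrite -card_draws -sum_nat_const.
apply: (@leq_trans (\sum_(A in H) #|charged A|)).
  by apply: leq_sum => A AH; apply: card_charged.
have -> : \sum_(A in H) #|charged A| = \sum_(X : {set T}) \sum_(A in H) (X \in charged A).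
  rewrite exchange_big /=; apply: eq_bigr => A _; rewrite -sum1_card big_mkcond /=.
  by apply: eq_bigr => X _; case: (X \in _).
rewrite -sum1_card [leqRHS]big_mkcond /=; apply: leq_sum => X _.
have [A /andP[AH XA]|none] := pickP (fun A => (A \in H) && (X \in charged A)); last first.
  by rewrite big1 // => A AH; have := none A; rewrite AH /= => ->.
have -> : X \in [set X : {set T} | #|X| == k] by move: XA; rewrite !inE => /and3P[].
rewrite (bigD1 A) //= XA big1 ?addn0 // => B /andP[BH BA].
case: (boolP (X \in charged B)) => // XB.
by case/eqP: BA; apply: (charged_disjoint BH AH XB XA).
Qed.

End UpperBound.

(** The additive term, constant in [n], absorbs families of fewer than [2 t] edges, for which
    padding is impossible. *)
Lemma maxCancellative_upper (t k n : nat) : 0 < t -> 0 < k ->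
  maxCancellative (2 * (t - 1)) n (t * k) * 'C(t * k - 1, k - 1) <=
  'C(n, k) + 2 * t * 'C(t * k - 1, k - 1).
Proof.
move=> t0 k0.
have [H /andP[rH cH] ->] : exists2 H : {set {set 'I_n}}, rgraph (t * k) H && cancellative (2 * (t - 1)) H
     & maxCancellative (2 * (t - 1)) n (t * k) = #|H|.
  have P0 : rgraph (t * k) (set0 : {set {set 'I_n}}) && cancellative (2 * (t - 1)) (set0 : {set {set 'I_n}}).
    apply/andP; split; first by apply/forall_inP => A; rewrite inE.
    do 3![apply/forallP => ?]; apply/implyP; by rewrite in_set0 andbF.
  have [H PH e] := @eq_bigmax_cond _ (fun H : {set {set 'I_n}} => rgraph (t * k) H && cancellative (2 * (t - 1)) H)
     (fun H => #|H|) ltac:(by apply/card_gt0P; exists set0).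
  by exists H.
have [lt|ge] := ltnP #|H| (2 * t).
  by apply: leq_trans (leq_addl _ _); rewrite leq_mul2r ltnW ?orbT.
apply: leq_trans (leq_addr _ _).
by have := upper_bound t0 k0 rH cH ge; rewrite card_ord.
Qed.

(* Passage to the limit *)
From mathcomp Require Import all_classical all_reals all_analysis.
Import numFieldNormedType.Exports.
Local Open Scope classical_set_scope.
Local Open Scope ring_scope.

Theorem theorem1p1 (R : realType) (t k : nat) (ht : (2 <= t)%N) (hk : (2 <= k)%N) :
  ((maxCancellative (2 * (t - 1)) n (t * k))%:R / n%:R ^+ k : R) @[n --> \oo]
    --> (1 / k`!%:R * (1 / 'C(t * k - 1, k - 1)%:R) : R).
Proof.
set C := 'C(t * k - 1, k - 1).
have C0 : (0 < C)%N by rewrite bin_gt0; move: ht hk; clear; nia.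
pose D : R := (k`! * C)%:R.
have D0 : 0 < D by rewrite ltr0n muln_gt0 fact_gt0.
have -> : 1 / k`!%:R * (1 / C%:R) = D^-1 :> R.
  by rewrite !div1r -invfM -natrM.
apply/cvgrPdist_lt => e e0.
(* The distance to the limit is [|n ^ k - D a| / (D n ^ k)], at most [eta / D = e / 2]. *)
pose eta := e * D / 2.
have eta0 : 0 < eta by rewrite divr_gt0 ?mulr_gt0.
have [N hN] := maxCancellative_lower ht hk eta0.
have [M hM] := nat_above ((2 * t * C * k`!)%:R / eta).
exists (maxn N M).+1 => // n /= hn.
have [Nn Mn n0] : [/\ (N <= n)%N, (M <= n)%N & (0 < n)%N] by split; move: hn; clear; lia.
set a := maxCancellative _ _ _.
have nk0 : 0 < n%:R ^+ k :> R by rewrite exprn_gt0 // ltr0n.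
have lo : (1 - eta) * n%:R ^+ k <= D * a%:R := hN n Nn.
have hi : D * a%:R <= (1 + eta) * n%:R ^+ k.
  have K_small : (2 * t * C * k`!)%:R <= eta * n%:R ^+ k.
    have := hM n Mn; rewrite ler_pdivrMr // mulrC => /le_trans; apply.
    rewrite ler_wpM2l ?(ltW eta0) // -natrX ler_nat -[leqLHS]expn1 leq_pexp2l //.
    exact: ltnW.
  rewrite mulrDl mul1r; apply: le_trans (lerD (lexx _) K_small).
  rewrite -natrX -natrD -natrM ler_nat.
  have t0 : (0 < t)%N by apply: ltnW.
  have k0 : (0 < k)%N by apply: ltnW.
  rewrite -mulnA [(C * a)%N]mulnC mulnC.
  apply: leq_trans (leq_mul (maxCancellative_upper n t0 k0) (leqnn _)) _.
  by rewrite mulnDl leq_add2r bin_ffact ffact_le_expn.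
have diff_quot (x y z : R) : 0 < x -> 0 < z -> x^-1 - y / z = (z - x * y) / (x * z).
  by move=> x0 z0; field; rewrite !gt_eqF.
rewrite diff_quot //.
have Dn0 : 0 < D * n%:R ^+ k by rewrite mulr_gt0.
rewrite normrM normfV (gtr0_norm Dn0) ltr_pdivrMr //.
apply: (@le_lt_trans _ _ (eta * n%:R ^+ k)).
  by rewrite ler_norml; apply/andP; split; lra.
by rewrite mulrA ltr_pM2r // /eta ltr_pdivrMr // ltr_pMr ?mulr_gt0 ?ltr1n.
Qed.
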